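(* The value function $\omega:\mathbb R^7\times[0,\infty)\to\mathbb R$, $$\omega(r_0,t_f)=\inf_{(\mathbf r,\mathbf u)\in\Pi_{r_0,t_f}}\max\Big\{\nu(\mathbf r(0)),\ \max_{\tau\in[-t_f,0]}g(\mathbf r(\tau))\Big\},$$ is the unique continuous viscosity solution of the quasi-variational inequality $$\min\big\{\omega(r,t)-g(r),\ \partial_t\omega(r,t)+H(r,\nabla_r\omega(r,t))\big\}=0\quad\text{for } t\in(0,\infty),\ r\in\mathbb R^7,$$ $$\omega(r,0)=\max\{\nu(r),g(r)\}\quad\text{for all } r\in\mathbb R^7,$$ where $H(r,q)=-\min_{u\in\mathcal U}\big(q^Tf(r,u)\big)$ for $r,q\in\mathbb R^7$.
   Context: Controls: $T_{\max}>0$, $\mathcal U=[-\pi,\pi]\times[-\tfrac{\pi}{2},\tfrac{\pi}{2}]\times[0,T_{\max}]$, and $\mathcal U_{ad}$ is the set of Lebesgue measurable functions from $(-\infty,0]$ to $\mathcal U$. Dynamics: $f:\mathbb R^7\times\mathcal U\to\mathbb R^7$ (in the paper, the vector field of a spacecraft with state $r=(\rho,\theta,\psi,v_\rho,v_t,v_\perp,\Delta m)$). Standing assumptions: $f$ is continuous and bounded; there is $L_f>0$ such that $\|f(r_1,u)-f(r_2,u)\|\le L_f\|r_1-r_2\|$ for all $r_1,r_2\in\mathbb R^7$, $u\in\mathcal U$; for every $r\in\mathcal K$ the set $\{f(r,u):u\in\mathcal U\}$ is a compact convex subset of $\mathbb R^7$. Sets: $\mathcal K=\{r\in\mathbb R^7:\rho\in[\rho_{\min},\rho_{\max}],\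 \Delta m\in[m_{\min},m_{\max}]\}$, where $\rho$ and $\Delta m$ are the first and seventh components of $r$, $0<\rho_{\min}<\rho_{\max}$ and $0=m_{\min}<m_{\max}$; $\mathcal C\subset\mathcal K$ is closed. Trajectories: for $r_0\in\mathbb R^7$, $t_f\ge0$, $\Pi_{r_0,t_f}$ is the set of pairs $(\mathbf r,\mathbf u)$ with $\mathbf u\in\mathcal U_{ad}$ and $\mathbf r:[-t_f,0]\to\mathbb R^7$ absolutely continuous, $\dot{\mathbf r}(t)=f(\mathbf r(t),\mathbf u(t))$ for a.e. $t\in[-t_f,0]$, and $\mathbf r(-t_f)=r_0$. Level-set functions: $g,\nu:\mathbb R^7\to\mathbb R$ are Lipschitz functions with $g(r)\le0\iff r\in\mathcal K$ and $\nu(r)\le0\iff r\in\mathcal C$. Viscosity solution: a continuous $w:\mathbb R^7\times[0,\infty)\to\mathbb R$ satisfying the initial condition is a viscosity solution if for every $C^1$ function $\phi$ on $\mathbb R^7\times(0,\infty)$ and every $(r,t)$ with $t>0$: if $w-\phi$ has a local maximum at $(r,t)$ then $\min\{w(r,t)-g(r),\partial_t\phi(r,t)+H(r,\nabla_r\phi(r,t))\}\le0$, and if $w-\phi$ has a local minimum at $(r,t)$ then this same quantity (with that $\phi$) is $\ge0$. *)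

(* Defs.v *)
From HB Require Import structures.
From mathcomp Require Import all_boot all_order all_algebra.
From mathcomp Require Import all_classical all_reals all_analysis.

Set Implicit Arguments.
Unset Strict Implicit.
Unset Printing Implicit Defensive.

Import Order.TTheory GRing.Theory Num.Theory.
Import numFieldNormedType.Exports.

Local Open Scope classical_set_scope.
Local Open Scope ring_scope.

Notation state R := 'rV[R]_7.
Notation control R := 'rV[R]_3.

Definition control_set (R : realType) (Tmax : R) : set (control R) :=
  [set u | [/\ - pi <= u 0 (inord 0) <= pi,
               - (pi / 2) <= u 0 (inord 1) <= pi / 2 &
               0 <= u 0 (inord 2) <= Tmax]].

(* The domain carries the Lebesgue (Caratheodory) sigma-algebra of the real
   line rather than the Borel one, the codomain its Borel sigma-algebra. *)
Definition lebesgue_measurable_fun (R : realType) n (D : set R)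
    (u : R -> 'rV[R]_n) : Prop :=
  @measurable_fun _ _ (caratheodory_type (@wlength R idfun)^*%mu)
    (g_sigma_algebraType (@open 'rV[R]_n)) D u.

(* Functions on (-oo, 0] or [-tf, 0] are total functions whose values outside
   the domain are ignored. *)
Definition admissible_control (R : realType) (Tmax : R)
    (u : R -> control R) : Prop :=
  lebesgue_measurable_fun `]-oo, 0%R] u /\
  forall t, t <= 0 -> control_set Tmax (u t).

Definition constraint_set (R : realType) (rho_min rho_max m_min m_max : R) :
    set (state R) :=
  [set r | rho_min <= r 0 ord0 <= rho_max /\ m_min <= r 0 ord_max <= m_max].

Definition abs_continuous (R : realType) (V : normedModType R) (a b : R)
    (x : R -> V) : Prop :=
  forall e : R, 0 < e -> exists2 d : R, 0 < d &
    forall n (s : 'I_n -> R * R),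
      (forall i, [/\ a <= (s i).1, (s i).1 <= (s i).2 & (s i).2 <= b]) ->
      trivIset setT (fun i => `](s i).1, (s i).2[%classic) ->
      \sum_(i < n) ((s i).2 - (s i).1) < d ->
      \sum_(i < n) `|x (s i).2 - x (s i).1| < e.

Definition trajectories (R : realType) (Tmax : R)
    (f : state R -> control R -> state R) (r0 : state R) (tf : R) :
    set ((R -> state R) * (R -> control R)) :=
  [set ru | [/\ admissible_control Tmax ru.2,
                abs_continuous (- tf) 0 ru.1,
                {ae (@lebesgue_measure R), forall t, t \in `[- tf, 0] ->
                   is_derive t 1 ru.1 (f (ru.1 t) (ru.2 t))} &
                ru.1 (- tf) = r0]].

(* For continuous g and r the supremum is a maximum: see running_max_attained. *)
Definition trajectory_cost (R : realType) (g nu : state R -> R) (tf : R)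
    (r : R -> state R) : R :=
  Num.max (nu (r 0)) (sup [set g (r tau) | tau in `[- tf, 0]]).

Definition value_function (R : realType) (Tmax : R)
    (f : state R -> control R -> state R) (g nu : state R -> R)
    (p : state R * R) : R :=
  inf [set trajectory_cost g nu p.2 ru.1 | ru in trajectories Tmax f p.1 p.2].

Definition dotp (R : realType) n (q v : 'rV[R]_n) : R :=
  \sum_(i < n) q 0 i * v 0 i.

(* For continuous f the infimum is a minimum: see hamiltonian_attained. *)
Definition hamiltonian (R : realType) (Tmax : R)
    (f : state R -> control R -> state R) (r q : state R) : R :=
  - inf [set dotp q (f r u) | u in control_set Tmax].

(* In finite dimension, continuity of p |-> 'd phi p amounts to continuity of
   p |-> 'D_v phi p for each v. *)
Definition C1_on (R : realType) (V : normedModType R) (A : set V)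
    (phi : V -> R) : Prop :=
  forall p, A p -> differentiable phi p /\
    forall v, {for p, continuous (fun x => 'D_v phi x)}.

Definition partial_t (R : realType) n (phi : 'rV[R]_n * R -> R)
    (p : 'rV[R]_n * R) : R :=
  derive1 (fun s : R => phi (p.1, s)) p.2.

Definition grad_r (R : realType) n (phi : 'rV[R]_n * R -> R)
    (p : 'rV[R]_n * R) : 'rV[R]_n :=
  \row_i 'D_(delta_mx 0 i) (fun x : 'rV[R]_n => phi (x, p.2)) p.1.

Definition local_max (R : realType) (T : topologicalType) (h : T -> R)
    (p : T) : Prop := \forall x \near p, h x <= h p.

Definition local_min (R : realType) (T : topologicalType) (h : T -> R)
    (p : T) : Prop := \forall x \near p, h p <= h x.

Definition qvi_operator (R : realType) (H : state R -> state R -> R)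
    (g : state R -> R) (w phi : state R * R -> R) (p : state R * R) : R :=
  Num.min (w p - g p.1) (partial_t phi p + H p.1 (grad_r phi p)).

Definition viscosity_solution (R : realType) (H : state R -> state R -> R)
    (g nu : state R -> R) (w : state R * R -> R) : Prop :=
  [/\ {within [set p | 0 <= p.2], continuous w},
      (forall r, w (r, 0) = Num.max (nu r) (g r)) &
      forall phi : state R * R -> R, C1_on [set p : state R * R | 0 < p.2] phi ->
        forall p, 0 < p.2 ->
          (local_max (fun x => w x - phi x) p ->
             qvi_operator H g w phi p <= 0) /\
          (local_min (fun x => w x - phi x) p ->
             0 <= qvi_operator H g w phi p)].

Lemma running_max_attained (R : realType) (g : state R -> R) (tf : R)
    (r : R -> state R) :
  0 <= tf -> continuous g -> {within `[- tf, 0], continuous r} ->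
  exists2 t, t \in `[- tf, 0] &
    sup [set g (r tau) | tau in `[- tf, 0]] = g (r t) /\
    forall tau, tau \in `[- tf, 0] -> g (r tau) <= g (r t).
Proof.
move=> tf0 cg cr; have tfle : - tf <= 0 by rewrite oppr_le0.
have cgr : {within `[- tf, 0], continuous (g \o r)}.
  by move=> x; apply: (@continuous_comp (subspace _)); [exact: cr|exact: cg].
have [t tI tmax] := EVT_max tfle cgr.
exists t => //; split; last by move=> tau /tmax.
have ub : ubound [set g (r tau) | tau in `[- tf, 0]] (g (r t)).
  by move=> _ [tau tauI <-]; exact: tmax.
apply/eqP; rewrite eq_le; apply/andP; split.
  by apply: ge_sup => //; exists (g (r t)), t.
by apply: ub_le_sup; [exists (g (r t))|exists t].
Qed.

Lemma control_set_compact (R : realType) (Tmax : R) :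
  compact (control_set Tmax).
Proof.
pose A (i : 'I_3) : set R :=
  if i == inord 0 then `[- pi, pi]%classic
  else if i == inord 1 then `[- (pi / 2), pi / 2]%classic
  else `[0, Tmax]%classic.
rewrite (_ : control_set Tmax = [set v | forall i, A i (v ord0 i)]).
  by apply: rV_compact => i; rewrite /A; do 2?case: ifP => _;
    exact: segment_compact.
have E (i : 'I_3) : [\/ i = inord 0, i = inord 1 | i = inord 2].
  by case: i => -[|[|[|//]]] ?; [apply: Or31|apply: Or32|apply: Or33];
    apply: val_inj; rewrite /= inordK.
have A0 : A (inord 0) = `[- pi, pi]%classic by rewrite /A eqxx.
have A1 : A (inord 1) = `[- (pi / 2), pi / 2]%classic.
  by rewrite /A eqxx -val_eqE /= !inordK.
have A2 : A (inord 2) = `[0, Tmax]%classic by rewrite /A -!val_eqE /= !inordK.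
apply/seteqP; split => [v [v0 v1 v2] i|v Av].
  by case: (E i) => ->; rewrite ?A0 ?A1 ?A2 /= in_itv.
by split; [have := Av (inord 0)|have := Av (inord 1)|have := Av (inord 2)];
  rewrite ?A0 ?A1 ?A2 /= in_itv.
Qed.

Lemma dotp_continuous (R : realType) n (q : 'rV[R]_n) : continuous (dotp q).
Proof.
rewrite /dotp => v; elim: (index_enum _) => [|i s IH].
  rewrite (_ : (fun _ => _) = fun=> 0); first exact: cst_continuous.
  by apply/funext => x; rewrite big_nil.
rewrite (_ : (fun _ => _) =
  fun x : 'rV[R]_n => q 0 i * x 0 i + \sum_(j <- s) q 0 j * x 0 j); last first.
  by apply/funext => x; rewrite big_cons.
apply: continuousD IH; apply: continuousM; first exact: cst_continuous.
exact: coord_continuous.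
Qed.

Lemma hamiltonian_attained (R : realType) (Tmax : R)
    (f : state R -> control R -> state R) (r q : state R) :
  0 <= Tmax ->
  {within [set p : state R * control R | control_set Tmax p.2],
    continuous (fun p => f p.1 p.2)} ->
  exists2 u, control_set Tmax u &
    hamiltonian Tmax f r q = - dotp q (f r u) /\
    forall u', control_set Tmax u' -> dotp q (f r u) <= dotp q (f r u').
Proof.
move=> T0 /subspace_continuousP cf.
have U0 : control_set Tmax 0.
  by split; rewrite !mxE ?oppr_le0 ?lexx ?T0 ?divr_ge0 ?pi_ge0.
have cfr : {within control_set Tmax, continuous (f r)}.
  apply/subspace_continuousP => u Uu P /(cf (r, u) Uu).
  case=> -[B1 B2] /= [nB1 nB2] sB; rewrite /within /=.
  apply: filterS nB2 => u' B2u' Uu'; apply: (sB (r, u')) => //.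
  by split => //=; exact: nbhs_singleton.
have cqf : {within control_set Tmax, continuous (dotp q \o f r)}.
  by move=> x; apply: (@continuous_comp (subspace _));
    [exact: cfr|exact: dotp_continuous].
have [|u] := compact_EVT_min _ (@control_set_compact R Tmax) cqf.
  by exists 0.
rewrite inE => Uu umin.
have lbu u' : control_set Tmax u' -> dotp q (f r u) <= dotp q (f r u').
  by move=> ?; apply: umin; rewrite inE.
exists u => //; split=> //; rewrite /hamiltonian; congr (- _).
have lb : lbound [set dotp q (f r u) | u in control_set Tmax] (dotp q (f r u)).
  by move=> _ [u' Uu' <-]; exact: lbu.
apply/eqP; rewrite eq_le; apply/andP; split.
  by apply: ge_inf; [exists (dotp q (f r u))|exists u].
by apply: lb_le_inf => //; exists (dotp q (f r u)), u.
Qed.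

(* Main.v *)
(* The value function is compared with the value [V] obtained from piecewise
   constant controls only. Lipschitz estimates for the flows of constant controls
   make [V] locally Lipschitz, and the dynamic programming inequalities obtained by
   inserting or removing an initial constant arc make it a viscosity solution.

   Every finite list of constant controls is a trajectory, so the value function is
   at most [V]. Conversely, along an arbitrary trajectory [x] with control [u], at
   almost every time [s] the curve [x] is tangent to the flow of the constant control
   [u s]; hence [s |-> max (V (x s, - s)) (max g)] is absolutely continuous with a
   nonnegative lower Dini derivative almost everywhere, thus nondecreasing, and [V]
   is at most the cost of the trajectory.

   Uniqueness is a comparison principle by doubling of variables. Since [f] is bounded,
   [H] is Lipschitz in the gradient, so that a barrier growing fast enough in time
   localizes the argument and no growth condition on solutions is required. *)

Require Import Defs.
From HB Require Import structures.
From mathcomp Require Import all_boot all_order all_algebra.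
From mathcomp Require Import all_classical all_reals all_analysis.
From mathcomp Require Import ring lra.

Import Order.TTheory GRing.Theory Num.Theory.
Import numFieldNormedType.Exports.

Set Implicit Arguments.
Unset Strict Implicit.
Unset Printing Implicit Defensive.

Local Open Scope classical_set_scope.
Local Open Scope ring_scope.

(** * Monotonicity from lower Dini derivatives *)

(** The detour through [V] avoids solving equations that are merely measurable in time. Perturbing
    the initial point under a measurable control would require such solutions, whereas constant
    controls only need autonomous Lipschitz equations, which Picard iteration solves. The price is
    the inequality along arbitrary trajectories. There [x] has derivative [f (x s) (u s)] at almost
    every [s], and this pointwise fact is all that is used: no Lebesgue points of [u] and no
    approximation of [u] by step functions. The exceptional null set is covered by a short open set,
    on which absolute continuity makes the possible loss small. In the comparison principle the
    compact box is fixed first, from [M] and the point where the solutions differ. Only then is the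
    size [S] of the difference on the box known, so the barrier cannot be chosen large in advance.
    Raising it to a high power repairs this: the power exceeds [S] where the barrier is at least 2,
    equals 1 at the centre, and still satisfies the differential inequality. *)

(** The supremum of the points satisfying [P] satisfies it by the limit clause, and by the step
    clause it cannot lie below [b]. *)
Lemma real_induction (R : realType) (a b : R) (P : R -> Prop) :
  a <= b -> P a ->
  (forall c, a <= c -> c < b -> P c ->
     exists2 d : R, 0 < d & forall k : R, 0 < k -> k < d -> c + k <= b -> P (c + k)) ->
  (forall c, a < c -> c <= b ->
     (forall d : R, 0 < d -> exists c', [/\ a <= c', c' <= c, c - d < c' & P c']) ->
     P c) ->
  P b.
Proof.
move=> ab Pa step lim.
pose S := [set c | [/\ a <= c, c <= b & P c]].
have Sa : S a by split.
have S0 : S !=set0 by exists a.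
have bS : has_ubound S by exists b => c [].
have hS : has_sup S by split.
set m := sup S.
have am : a <= m by apply: ub_le_sup.
have mb : m <= b by apply: ge_sup => // c [].
have Pm : P m.
  have := am; rewrite le_eqVlt => /orP[/eqP <- //|am'].
  apply: lim => // d d0.
  have [c [ac cb Pc] mc] := sup_adherent d0 hS.
  by exists c; split => //; apply: ub_le_sup.
have := mb; rewrite le_eqVlt => /orP[/eqP <- //|mb'].
have [d d0 Pd] := step _ am mb' Pm.
pose k := Num.min (d / 2) (b - m).
have k0 : 0 < k by rewrite lt_min divr_gt0// subr_gt0.
have kd : k < d by rewrite gt_min; apply/orP; left; lra.
have kb : m + k <= b by rewrite -lerBrDl ge_min lexx orbT.
have : m + k <= m.
  by apply: ub_le_sup => //; split => //; [lra|exact: Pd].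
by rewrite gerDl leNgt k0.
Qed.

Definition continuous_seg (R : realType) (a b : R) (h : R -> R) :=
  forall s, a <= s <= b -> forall e : R, 0 < e -> exists2 d : R, 0 < d &
    forall s', a <= s' <= b -> `|s' - s| < d -> `|h s' - h s| < e.

(* [O] collects the points where nothing is known about the increments of [h]:
   the total loss there is bounded by the variation of [h] on a finite family
   of disjoint subintervals of [O]. *)
Lemma dini_loss (R : realType) (h : R -> R) (a b e : R) (O : set R) :
  a <= b -> 0 <= e -> continuous_seg a b h ->
  (forall s, a <= s -> s < b ->
     exists2 d : R, 0 < d &
       (forall k : R, 0 < k -> k < d -> `[s, s + k] `<=` O) \/
       (forall k : R, 0 < k -> k < d -> s + k <= b -> h s <= h (s + k) + e * k)) ->
  forall eta : R, 0 < eta -> exists n (s : 'I_n -> R * R),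
    [/\ forall i, [/\ a <= (s i).1, (s i).1 <= (s i).2 & (s i).2 <= b],
        forall i, `](s i).1, (s i).2[ `<=` O,
        trivIset setT (fun i => `](s i).1, (s i).2[%classic) &
        h a <= h b + e * (b - a) + \sum_(i < n) `|h (s i).2 - h (s i).1| + eta].
Proof.
move=> ab e0 ch loc.
(* [eta] is quantified inside the invariant: reaching a limit point costs a small jump of [h], paid
   for by using [eta / 2] at the point before it. *)
pose P c := forall eta : R, 0 < eta -> exists n (s : 'I_n -> R * R),
    [/\ forall i, [/\ a <= (s i).1, (s i).1 <= (s i).2 & (s i).2 <= c],
        forall i, `](s i).1, (s i).2[ `<=` O,
        trivIset setT (fun i => `](s i).1, (s i).2[%classic) &
        h a <= h c + e * (c - a) + \sum_(i < n) `|h (s i).2 - h (s i).1| + eta].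
apply: (@real_induction _ a b P) => //.
- move=> eta eta0; exists 0%N, (fun=> (0, 0)); split; [by case..| |].
    by move=> [].
  by rewrite big_ord0; lra.
- move=> c ac cb Pc; have [d d0 [bad|good]] := loc c ac cb.
  (* Where nothing is known, the interval from [c] to [c + k] joins the family as its last member,
     and its own variation pays for the loss. *)
  + exists d => // k k0 kd ckb eta eta0.
    have [n [s [s1 s2 s3 s4]]] := Pc _ eta0.
    pose s' (i : 'I_n.+1) := if unlift ord_max i is Some j then s j else (c, c + k).
    have s'm : s' ord_max = (c, c + k) by rewrite /s' unlift_none.
    have s'l j : s' (lift ord_max j) = s j by rewrite /s' liftK.
    exists n.+1, s'; split.
    * move=> i; case: (unliftP ord_max i) => [j ->|->]; rewrite ?s'l ?s'm.
        by have [? ? ?] := s1 j; split => //; lra.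
      by split => /=; lra.
    * move=> i; case: (unliftP ord_max i) => [j ->|->]; rewrite ?s'l ?s'm//=.
      apply: subset_trans (bad k k0 kd).
      by apply: subset_itvW; rewrite bnd_simp.
    * move=> i j _ _; case: (unliftP ord_max i) => [i' ->|->];
        case: (unliftP ord_max j) => [j' ->|->] //; rewrite ?s'l ?s'm//=.
      - by move=> /(s3 _ _ Logic.I Logic.I) ->.
      - move=> [x []]; rewrite /= !in_itv/= => /andP[_ x1] /andP[x2 _].
        by exfalso; have [_ _ ?] := s1 i'; lra.
      - move=> [x []]; rewrite /= !in_itv/= => /andP[x2 _] /andP[_ x1].
        by exfalso; have [_ _ ?] := s1 j'; lra.
    * have ek0 : 0 <= e * k by rewrite mulr_ge0// ltW.
      rewrite big_ord_recr/= -/(s' ord_max) s'm /=.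
      have -> : \sum_(i < n) `|h (s' (widen_ord (leqnSn n) i)).2 -
         h (s' (widen_ord (leqnSn n) i)).1| = \sum_(i < n) `|h (s i).2 - h (s i).1|.
        apply: eq_bigr => i _.
        suff -> : widen_ord (leqnSn n) i = lift ord_max i by rewrite s'l.
        by apply: val_inj; rewrite /= /bump leqNgt ltn_ord.
      have := ler_norm (h c - h (c + k)); rewrite distrC => H.
      rewrite (_ : e * (c + k - a) = e * (c - a) + e * k); last by ring.
      lra.
  + exists d => // k k0 kd ckb eta eta0.
    have [n [s [s1 s2 s3 s4]]] := Pc _ eta0; exists n, s; split => //.
      by move=> i; have [? ? ?] := s1 i; split => //; lra.
    have := good k k0 kd ckb.
    rewrite (_ : e * (c + k - a) = e * (c - a) + e * k); last by ring.
    lra.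
- move=> c ac cb Pc eta eta0.
  have e20 : 0 < eta / 2 by lra.
  have [|d d0 hd] := ch c _ (eta / 2) e20; first by lra.
  have [c' [ac' c'c c'd Pc']] := Pc _ d0.
  have [n [s [s1 s2 s3 s4]]] := Pc' _ e20.
  exists n, s; split => //.
    by move=> i; have [? ? ?] := s1 i; split => //; lra.
  have c'b : a <= c' <= b by lra.
  have cc : `|c' - c| < d by rewrite ltr_norml; lra.
  have := hd c' c'b cc; rewrite ltr_norml => /andP[h1 h2].
  have : e * (c' - a) <= e * (c - a) by rewrite ler_wpM2l//; lra.
  lra.
Qed.

Lemma dini_nondecreasing (R : realType) (h : R -> R) (a b : R) :
  a <= b -> continuous_seg a b h ->
  (forall e : R, 0 < e -> forall s, a <= s -> s < b ->
     exists2 d : R, 0 < d &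
       forall k : R, 0 < k -> k < d -> s + k <= b -> h s <= h (s + k) + e * k) ->
  h a <= h b.
Proof.
move=> ab ch loc; apply/ler_addgt0Pr => eta eta0.
pose e : R := eta / 2 / (b - a + 1).
have ba1 : 0 < b - a + 1 by lra.
have e0 : 0 < e by rewrite !divr_gt0.
have [//||//|s as_ sb||] := @dini_loss _ h a b e set0 _ _ _ _ (eta / 2).
- exact: ltW.
- by have [d d0 hd] := loc _ e0 s as_ sb; exists d => //; right.
- by lra.
move=> n [s [s1 s2 _ H]].
have -> : eta = e * (b - a) + e + eta / 2.
  by rewrite {1 2}/e; field; rewrite gt_eqF.
(* The exceptional set is empty here, so every interval of the family is degenerate. *)
have : \sum_(i < n) `|h (s i).2 - h (s i).1| = 0.
  apply: big1 => i _; have [_ si _] := s1 i.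
  suff -> : (s i).1 = (s i).2 by rewrite subrr normr0.
  apply/eqP; rewrite eq_le si/= leNgt; apply/negP => ss.
  by apply: (s2 i ((((s i).1 + (s i).2) / 2))) => /=; rewrite in_itv/=; lra.
lra.
Qed.

Lemma abs_continuous_dist (R : realType) (V : normedModType R) (h : R -> V)
    (a b e : R) : abs_continuous a b h -> 0 < e -> exists2 d : R, 0 < d &
  forall s s', a <= s <= b -> a <= s' <= b -> `|s' - s| < d -> `|h s' - h s| < e.
Proof.
move=> ach e0; have [d d0 hd] := ach e e0.
exists d => // s s' sab s'ab ss'.
have H p q : a <= p -> p <= q -> q <= b -> q - p < d -> `|h q - h p| < e.
  move=> ap pq qb qp.
  have := hd 1%N (fun=> (p, q)); rewrite !big_ord1/=; apply => //.
  by move=> i j _ _ _; rewrite !ord1.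
move: sab s'ab ss' => /andP[? ?] /andP[? ?].
have [ss'|s's] := leP s s'.
  by rewrite ger0_norm ?subr_ge0// => ?; apply: H.
by rewrite ltr0_norm ?subr_lt0// => ?; rewrite distrC; apply: H => //; lra.
Qed.

Lemma abs_continuous_seg (R : realType) (h : R -> R) (a b : R) :
  abs_continuous a b h -> continuous_seg a b h.
Proof.
move=> ach s sab e e0; have [d d0 hd] := abs_continuous_dist ach e0.
by exists d => // s' s'ab; exact: hd.
Qed.

Lemma total_length_le_measure (R : realType) n (s : 'I_n -> R * R) (O : set R) :
  measurable O -> (forall i, (s i).1 <= (s i).2) ->
  (forall i, `](s i).1, (s i).2[ `<=` O) ->
  trivIset setT (fun i => `](s i).1, (s i).2[%classic) ->
  ((\sum_(i < n) ((s i).2 - (s i).1))%:E <= lebesgue_measure O)%E.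
Proof.
move=> mO s12 sO tr.
have mI i : measurable (`](s i).1, (s i).2[%classic : set R) by exact: measurable_itv.
have H := measure_bigsetU_ord (@lebesgue_measure R) xpredT mI tr.
rewrite -sumEFin.
rewrite (eq_bigr (fun i => lebesgue_measure (`](s i).1, (s i).2[%classic : set R))).
  rewrite -[leLHS]H; apply: le_measure; rewrite ?inE//.
    exact: bigsetU_measurable.
  by apply: (big_ind (fun A => A `<=` O)) => // A B AO BO; rewrite subUset.
move=> i _; rewrite lebesgue_measure_itv/= lte_fin.
case: ltP => // s21; congr EFin.
by apply/eqP; rewrite subr_eq0 eq_le s21 s12.
Qed.

(** The null set lies in an open set shorter than the [d] that absolute continuity gives for
    [eta / 3], so the variation on disjoint intervals inside it stays below [eta / 3]. The slope [e]
    and the slack of [dini_loss] use the other two thirds. *)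
Lemma abs_continuous_nondecreasing (R : realType) (h : R -> R) (a b : R)
    (N : set R) :
  a <= b -> abs_continuous a b h -> (@lebesgue_measure R).-negligible N ->
  (forall e : R, 0 < e -> forall s, a <= s -> s < b -> ~ N s ->
     exists2 d : R, 0 < d &
       forall k : R, 0 < k -> k < d -> s + k <= b -> h s <= h (s + k) + e * k) ->
  h a <= h b.
Proof.
move=> ab ach [B0 [mB0 B00 NB]] loc.
have [B [mB B0' BE]] : exists B : set R,
    [/\ measurable B, lebesgue_measure B = 0%E & B0 = B] by exists B0.
rewrite {}BE {mB0 B00 B0} in NB.
rename B0' into B0; apply/ler_addgt0Pr => eta eta0.
pose e : R := eta / 3 / (b - a + 1).
have ba1 : 0 < b - a + 1 by lra.
have e0 : 0 < e by rewrite !divr_gt0//; lra.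
have eta30 : 0 < eta / 3 by lra.
have [d d0 hd] := ach _ eta30.
have Bfin : (lebesgue_measure B < +oo)%E by rewrite B0 ltry.
have [U [oU BU mUB]] := @lebesgue_regularity_outer R B d mB Bfin d0.
have mU : measurable U by exact: measurable_realfun.open_measurable.
have Ud : (lebesgue_measure U < d%:E)%E.
  rewrite (le_lt_trans _ mUB)//.
  have H := measureU2 (@lebesgue_measure R) (measurableD mU mB) mB.
  rewrite setUC setDUK// in H; apply: (le_trans H).
  by rewrite -[leRHS]adde0; apply: leeD => //; rewrite -B0.
have [//|||s as_ sb|//|n [s [s1 s2 s3 H]]] :=
    @dini_loss _ h a b e U _ _ _ _ (eta / 3).
- exact: ltW.
- exact: abs_continuous_seg.
- have [Ns|nNs] := pselect (N s); last first.
    by have [d' d'0 hd'] := loc _ e0 s as_ sb nNs; exists d' => //; right.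
  have /nbhs_ballP[r /= r0 sr] : nbhs s U.
    by apply: open_nbhs_nbhs; split => //; exact/BU/NB.
  exists r => //; left => k k0 kr x /=; rewrite in_itv/= => xk.
  by apply: sr; rewrite /ball/= ltr_norml; lra.
have lenU : (\sum_(i < n) ((s i).2 - (s i).1) < d)%R.
  rewrite -lte_fin (le_lt_trans _ Ud)// total_length_le_measure//.
  by move=> i; have [] := s1 i.
have := hd n s s1 s3 lenU.
have eE : e * (b - a) + e = eta / 3 by rewrite /e; field; rewrite gt_eqF.
lra.
Qed.

(** * Flows of bounded Lipschitz vector fields *)

Lemma rV_norm_le (R : realType) n (v : 'rV[R]_n) (c : R) :
  0 <= c -> (forall i, `|v 0 i| <= c) -> `|v| <= c.
Proof.
move=> c0 vc; rewrite /Num.Def.normr/= mx_normrE; apply: bigmax_le => //=.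
by move=> [i j] _; rewrite ord1.
Qed.

Lemma rV_coord_le (R : realType) n (v : 'rV[R]_n) i : `|v 0 i| <= `|v|.
Proof.
rewrite [leRHS]/Num.Def.normr/= mx_normrE.
exact: (le_bigmax _ (fun i : 'I_1 * 'I_n => `|v i.1 i.2|) (0, i)).
Qed.

Lemma nondecreasing_of_derive (R : realType) (h dh : R -> R) (a b : R) :
  a <= b -> (forall s, a <= s <= b -> is_derive s 1 h (dh s)) ->
  (forall s, a <= s <= b -> 0 <= dh s) -> h a <= h b.
Proof.
move=> ab hd dh0; rewrite -subr_ge0.
have [||c cab ->] := @MVT_segment _ h dh a b ab.
- move=> x; rewrite in_itv/= => /andP[ax xb]; apply: hd; lra.
- apply: derivable_within_continuous => x; rewrite in_itv/= => xab.
  by have [] := hd _ xab.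
by rewrite mulr_ge0 ?subr_ge0// dh0// -in_itv.
Qed.

Lemma lipschitz_bound_continuous (R : realType) (V W : normedModType R)
    (y : V -> W) (M : R) :
  (forall s t, `|y t - y s| <= M * `|t - s|) -> continuous y.
Proof.
move=> yM s; apply/cvgrPdist_lt => e e0.
have M1 : 0 < `|M| + 1 by rewrite ltr_wpDl.
have e1 : 0 < e / (`|M| + 1) by rewrite divr_gt0.
apply: filterS (nbhsx_ballx s _ e1) => t; rewrite -ball_normE/= => st.
rewrite (le_lt_trans (yM _ _))//.
apply: (@le_lt_trans _ _ ((`|M| + 1) * `|s - t|)).
  by rewrite ler_wpM2r// (le_trans (ler_norm _))// lerDl.
by rewrite mulrC -ltr_pdivlMr.
Qed.

(** Integration starts at -1 so that 0 is an interior point, where the derivative is two-sided; the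
    subtraction normalizes the value at 0. *)
Definition antiderivative (R : realType) (G : R -> R) (x : R) : R :=
  (\int[@lebesgue_measure R]_(t in `[-1, x]) G t) -
  (\int[@lebesgue_measure R]_(t in `[-1, 0]) G t).

Lemma antiderivative0 (R : realType) (G : R -> R) : antiderivative G 0 = 0.
Proof. by rewrite /antiderivative subrr. Qed.

Lemma is_derive_antiderivative (R : realType) (G : R -> R) (x : R) :
  continuous G -> -1 < x -> is_derive x 1 (antiderivative G) (G x).
Proof.
move=> cG x1.
have xx1 : x < x + 1 by rewrite ltrDl.
have iG : (@lebesgue_measure R).-integrable `[-1, x + 1] (EFin \o G).
  apply: continuous_compact_integrable; first exact: segment_compact.
  exact: continuous_subspaceT.
have [dG GE] := continuous_FTC1_closed xx1 iG x1 (cG x).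
rewrite derive1E in GE.
rewrite -[G x]subr0; apply: is_deriveB.
by rewrite -GE; exact: derivableP.
Qed.

Lemma le_of_geometric (R : realType) (a b K : R) :
  (forall n, a <= b + K * 2^-1 ^+ n) -> a <= b.
Proof.
move=> H; apply/ler_addgt0Pr => e e0.
have : (fun n => `|K| * 2^-1 ^+ n : R) @ \oo --> (0 : R).
  rewrite -[X in _ --> X](mulr0 `|K|); apply: cvgM; first exact: cvg_cst.
  apply: cvg_expr.
  by rewrite ger0_norm ?invr_ge0// invf_lt1// ltr1n.
move=> /cvgrPdist_lt /(_ e e0) [N _ /(_ N (leqnn N))].
rewrite sub0r normrN normrM normr_id -normrM => NE.
rewrite (le_trans (H N))// lerD2l (le_trans (ler_norm _))//.
exact: ltW.
Qed.

(** A quantitative substitute for the differential equation. The expansion is forward and includes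
    time 0, with a constant uniform in the curve; at negative times only the Lipschitz bound is
    required. *)
Definition flow_curve (R : realType) n (F : 'rV[R]_n -> 'rV[R]_n) (M C : R)
    (y : R -> 'rV[R]_n) : Prop :=
  (forall s t, `|y t - y s| <= M * `|t - s|) /\
  (forall s t, 0 <= s -> s <= t ->
     `|y t - y s - (t - s) *: F (y s)| <= C * (t - s) ^+ 2).

Lemma sum4_le (R : realType) (a1 a2 a3 a4 b1 b2 b3 b4 : R) :
  a1 <= b1 -> a2 <= b2 -> a3 <= b3 -> a4 <= b4 ->
  a1 + a2 + a3 + a4 <= b2 + (b1 + b3 + b4).
Proof. by lra. Qed.

(** * Existence of flows by Picard iteration *)

Section picard.
Context (R : realType) (n : nat) (F : 'rV[R]_n -> 'rV[R]_n) (L M : R).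
Hypotheses (L0 : 0 < L) (FL : forall x y, `|F x - F y| <= L * `|x - y|)
  (FM : forall x, `|F x| <= M).

Let M0 : 0 <= M. Proof. exact: le_trans (FM 0). Qed.

Let coord_comp_continuous (y : R -> 'rV[R]_n) i :
  continuous y -> continuous (fun s => F (y s) 0 i).
Proof.
move=> cy s; apply: (@continuous_comp _ _ _ (F \o y) (fun v => v 0 i)).
  apply: continuous_comp; first exact: cy.
  by apply: lipschitz_bound_continuous => a b; exact: FL.
exact: coord_continuous.
Qed.

(** Truncating time at 0 freezes each iterate at [r] for negative times, which makes the integrands
    continuous on the whole line. *)
Fixpoint picard (r : 'rV[R]_n) (k : nat) (s : R) : 'rV[R]_n :=
  if k is k'.+1 then
    \row_i (r 0 i +
      antiderivative (fun t => F (picard r k' (Num.max t 0)) 0 i) (Num.max s 0))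
  else r.

Let speed r k s := F (picard r k (Num.max s 0)).

Let picard0 r k s : s <= 0 -> picard r k s = r.
Proof.
case: k => //= k s0; apply/rowP => i; rewrite mxE max_r//.
by rewrite antiderivative0 addr0.
Qed.

Let picard_max r k s : picard r k (Num.max s 0) = picard r k s.
Proof. by case: k => //= k; rewrite -maxA maxxx. Qed.

Let deriv_const (c : R) (s : R) : is_derive s 1 (fun t : R => c * t) c.
Proof.
have /is_derive_eq := @is_deriveZ R R R id c s 1 1 (is_derive_id s 1).
by apply; rewrite /GRing.scale/= mulr1.
Qed.

(** Coordinatewise comparison of derivatives, used twice: [c = 0] and [B = M] give the Lipschitz
    bound, while [c] equal to the initial speed and [B = L * M * (t - s)] give the quadratic
    expansion. *)
Let picard_increment r k : continuous (picard r k) -> forall s t c B,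
  0 <= s -> s <= t -> (forall x, s <= x <= t -> `|speed r k x - c| <= B) ->
  `|picard r k.+1 t - picard r k.+1 s - (t - s) *: c| <= B * (t - s).
Proof.
move=> ck s t c B s0 st HB.
have B0 : 0 <= B by apply: le_trans (HB s _); rewrite ?lexx.
have csp i : continuous (fun x => speed r k x 0 i).
  apply: coord_comp_continuous.
  by rewrite (_ : (fun _ => _) = picard r k)//; apply/funext => x; rewrite picard_max.
apply: rV_norm_le => [|i]; first by rewrite mulr_ge0// subr_ge0.
rewrite !mxE -!/(speed r k _) !max_l//; last exact: le_trans st.
pose A := antiderivative (fun x => speed r k x 0 i).
have HBi x : s <= x <= t -> `|speed r k x 0 i - c 0 i| <= B.
  move=> /HB; apply: le_trans.
  by rewrite -[_ - _](_ : (speed r k x - c) 0 i = _) ?rV_coord_le// !mxE.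
have dA x : s <= x <= t -> is_derive x 1 A (speed r k x 0 i).
  by move=> xst; apply: (is_derive_antiderivative (csp i)); lra.
rewrite -/A ler_norml; apply/andP; split.
- have : A s - (c 0 i - B) * s <= A t - (c 0 i - B) * t.
    apply: (@nondecreasing_of_derive _ (fun x => A x - (c 0 i - B) * x)
      (fun x => speed r k x 0 i - (c 0 i - B)) _ _ st) => x xst.
      by apply: is_deriveB; [exact: dA|exact: deriv_const].
    by have := HBi x xst; rewrite ler_norml; lra.
  nra.
- have : (c 0 i + B) * s - A s <= (c 0 i + B) * t - A t.
    apply: (@nondecreasing_of_derive _ (fun x => (c 0 i + B) * x - A x)
      (fun x => (c 0 i + B) - speed r k x 0 i) _ _ st) => x xst.
      by apply: is_deriveB; [exact: deriv_const|exact: dA].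
    by have := HBi x xst; rewrite ler_norml; lra.
  nra.
Qed.

Let picard_lipschitz r k : forall s t,
  `|picard r k t - picard r k s| <= M * `|t - s|.
Proof.
elim: k => [|k IH] s t; first by rewrite subrr normr0 mulr_ge0.
have ck := lipschitz_bound_continuous IH.
have main a b : 0 <= a -> a <= b ->
    `|picard r k.+1 b - picard r k.+1 a| <= M * (b - a).
  move=> a0 ab; have := @picard_increment r k ck a b 0 M a0 ab.
  rewrite scaler0 subr0; apply => x _; rewrite subr0; exact: FM.
have main' a b : a <= b -> `|picard r k.+1 b - picard r k.+1 a| <= M * (b - a).
  move=> ab; rewrite -(picard_max _ _ b) -(picard_max _ _ a).
  have mab : Num.max a 0 <= Num.max b 0 by rewrite ge_max !le_max ab/= lexx orbT.
  rewrite (le_trans (main _ _ _ mab))//; first by rewrite le_max lexx orbT.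
  rewrite ler_wpM2l//.
  by rewrite /Num.max; case: ifP => a0; case: ifP => b0; lra.
have [st|ts] := leP s t.
  by rewrite [`|t - s|]ger0_norm ?subr_ge0//; exact: main'.
rewrite distrC [`|t - s|]distrC [`|s - t|]ger0_norm ?subr_ge0//; last exact: ltW.
by apply: main'; exact: ltW.
Qed.

Let cpicard r k : continuous (picard r k).
Proof. exact: lipschitz_bound_continuous (picard_lipschitz r k). Qed.

Let picard_flow r k s t : 0 <= s -> s <= t ->
  `|picard r k.+1 t - picard r k.+1 s - (t - s) *: F (picard r k s)|
    <= L * M * (t - s) ^+ 2.
Proof.
move=> s0 st; rewrite expr2 [leRHS]mulrA.
apply: picard_increment => // x /andP[sx xt].
rewrite /speed (le_trans (FL _ _))// -mulrA ler_wpM2l//; first exact: ltW.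
rewrite picard_max (le_trans (picard_lipschitz _ _ _ _))//.
by rewrite ger0_norm ?subr_ge0// ler_wpM2l// lerD2r.
Qed.

(** An exponential weight of Bielecki type. Since [L * E] is half the derivative of [E], one Picard
    step halves an error bounded by a multiple of [E], on all positive times and without any
    restriction on the step size. *)
Let E (s : R) := M / (2 * L) * expR (2 * L * s).

Let E0 s : 0 <= E s.
Proof. by rewrite mulr_ge0 ?expR_ge0// divr_ge0// mulr_ge0// ltW. Qed.

Let E20 s : 0 <= 2 * E s. Proof. exact: mulr_ge0. Qed.

Let dE (s : R) : is_derive s 1 E (M * expR (2 * L * s)).
Proof.
have H : is_derive s 1 (expR \o (fun t : R => 2 * L * t)) (expR (2 * L * s) * (2 * L)).
  by apply: is_derive1_comp; exact: deriv_const.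
have /is_derive_eq := is_deriveZ (M / (2 * L)) H.
by apply; rewrite /GRing.scale/=; field; rewrite gt_eqF.
Qed.

Let picard_contract r k s : 0 <= s ->
  `|picard r k.+1 s - picard r k s| <= E s * 2^-1 ^+ k.
Proof.
elim: k s => [|k IH] s s0.
  rewrite expr0 mulr1.
  have := picard_lipschitz r 1 0 s; rewrite subr0 (picard0 r 1 (lexx 0)) ger0_norm//.
  move/le_trans; apply; rewrite /E.
  have := expR_ge1Dx (2 * L * s) => H.
  rewrite -subr_ge0 (_ : _ - _ = M / (2 * L) * (expR (2 * L * s) - 2 * L * s)).
    by rewrite mulr_ge0 ?divr_ge0 ?mulr_ge0//; [exact: ltW|lra].
  by field; rewrite gt_eqF.
have q0 : 0 <= (2^-1 : R) ^+ k.+1 by rewrite exprn_ge0// invr_ge0.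
apply: rV_norm_le => [|i]; first by rewrite mulr_ge0.
rewrite !mxE -!/(speed r _ _) !max_l//.
rewrite opprD addrACA subrr add0r.
pose A j := antiderivative (fun x => speed r j x 0 i).
rewrite -[X in `|X|]/(A k.+1 s - A k s).
have csp j : continuous (fun x => speed r j x 0 i).
  apply: coord_comp_continuous.
  rewrite (_ : (fun _ => _) = picard r j); first exact: cpicard.
  by apply/funext => x; rewrite picard_max.
have dA j x : 0 <= x <= s -> is_derive x 1 (A j) (speed r j x 0 i).
  by move=> xst; apply: (is_derive_antiderivative (csp j)); lra.
have dEq (x : R) : is_derive x 1 (fun x => 2^-1 ^+ k.+1 * E x)
    (2^-1 ^+ k.+1 * (M * expR (2 * L * x))).
  exact: is_deriveZ.
have Hd x : 0 <= x <= s -> `|speed r k.+1 x 0 i - speed r k x 0 i| <=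
    2^-1 ^+ k.+1 * (M * expR (2 * L * x)).
  move=> /andP[x0 xs].
  rewrite -[_ - _](_ : (speed r k.+1 x - speed r k x) 0 i = _); last by rewrite !mxE.
  rewrite (le_trans (rV_coord_le _ _))// (le_trans (FL _ _))// !picard_max.
  rewrite (le_trans (ler_wpM2l _ (IH _ x0)))//; first exact: ltW.
  rewrite exprS le_eqVlt; apply/orP; left; apply/eqP.
  by rewrite /E; field; rewrite gt_eqF.
rewrite mulrC ler_norml; apply/andP; split.
- have : 2^-1 ^+ k.+1 * E 0 + (A k.+1 0 - A k 0) <=
      2^-1 ^+ k.+1 * E s + (A k.+1 s - A k s).
    apply: (@nondecreasing_of_derive _
      (fun x => 2^-1 ^+ k.+1 * E x + (A k.+1 x - A k x))
      (fun x => 2^-1 ^+ k.+1 * (M * expR (2 * L * x)) +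
        (speed r k.+1 x 0 i - speed r k x 0 i)) _ _ s0) => x xs.
      by apply: is_deriveD; apply: is_deriveB; exact: dA.
    by have := Hd x xs; rewrite ler_norml; lra.
  rewrite /A !antiderivative0 subrr addr0 -/A.
  have := mulr_ge0 q0 (E0 0); lra.
- have : 2^-1 ^+ k.+1 * E 0 - (A k.+1 0 - A k 0) <=
      2^-1 ^+ k.+1 * E s - (A k.+1 s - A k s).
    apply: (@nondecreasing_of_derive _
      (fun x => 2^-1 ^+ k.+1 * E x - (A k.+1 x - A k x))
      (fun x => 2^-1 ^+ k.+1 * (M * expR (2 * L * x)) -
        (speed r k.+1 x 0 i - speed r k x 0 i)) _ _ s0) => x xs.
      by apply: is_deriveB; apply: is_deriveB; exact: dA.
    by have := Hd x xs; rewrite ler_norml; lra.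
  rewrite /A !antiderivative0 subrr subr0 -/A.
  have := mulr_ge0 q0 (E0 0); lra.
Qed.

Let picard_cauchy r k j s : 0 <= s ->
  `|picard r (k + j) s - picard r k s| <= 2 * E s * 2^-1 ^+ k.
Proof.
move=> s0.
(* The partial geometric sum is kept exactly, so that the induction on [j] closes. *)
suff : `|picard r (k + j) s - picard r k s| <=
    2 * E s * (2^-1 ^+ k - 2^-1 ^+ (k + j)).
  move/le_trans; apply; rewrite ler_wpM2l ?E20//.
  by rewrite gerBl exprn_ge0// invr_ge0.
elim: j => [|j IH]; first by rewrite addn0 !subrr normr0 mulr0.
rewrite addnS -(subrKA (picard r (k + j) s)) (le_trans (ler_normD _ _))//.
rewrite (le_trans (lerD (picard_contract _ _ s0) IH))// exprS.
by rewrite le_eqVlt; apply/orP; left; apply/eqP; field.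
Qed.

Lemma ex_flow_curve (r : 'rV[R]_n) :
  exists2 y, y 0 = r & flow_curve F M (L * M) y.
Proof.
have cv s : cvg (picard r k s @[k --> \oo]).
  rewrite (_ : (fun k => _) = (fun k => picard r k (Num.max s 0))); last first.
    by apply/funext => k; rewrite picard_max.
  have s0 : 0 <= Num.max s 0 by rewrite le_max lexx orbT.
  move: (Num.max s 0) s0 => {}s s0.
  apply/cauchy_cvgP/cauchy_exP => e e0.
  have [N NE] : exists N, 2 * E s * 2^-1 ^+ N < e.
    apply: contrapT => /forallNP H.
    have : e <= 0.
      apply: (@le_of_geometric _ _ _ (2 * E s)) => n'.
      by rewrite add0r leNgt; apply/negP.
    by rewrite leNgt e0.
  exists (picard r N s), N => // k /= Nk.
  rewrite -ball_normE/= distrC -(subnKC Nk).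
  exact: le_lt_trans (picard_cauchy _ _ _ s0) NE.
pose y s : 'rV[R]_n := lim (picard r k s @[k --> \oo]).
have ycv s : picard r k s @[k --> \oo] --> y s by exact: cv.
have near_lim s k e : 0 < e -> exists2 m, (k <= m)%N & `|y s - picard r m s| < e.
  move=> e0; have /cvgrPdist_lt /(_ e e0)[N _ HN] := ycv s.
  exists (maxn k N); first exact: leq_maxl.
  by apply: HN => /=; exact: leq_maxr.
have ydist s k : 0 <= s -> `|y s - picard r k s| <= 2 * E s * 2^-1 ^+ k.
  move=> s0; apply/ler_addgt0Pr => e e0.
  have [m km Hm] := near_lim s k e e0.
  rewrite -(subrKA (picard r m s)) (le_trans (ler_normD _ _))// addrC lerD//.
    by rewrite -(subnKC km); exact: picard_cauchy.
  exact: ltW.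
exists y.
  apply/subr0_eq/eqP; rewrite -normr_le0; apply/ler_addgt0Pr => e e0.
  have [m _ Hm] := near_lim 0 0%N e e0.
  by rewrite add0r ltW//; move: Hm; rewrite picard0.
split=> [s t|s t s0 st].
  apply/ler_addgt0Pr => e e0.
  have e20 : 0 < e / 2 by rewrite divr_gt0.
  have /cvgrPdist_lt /(_ _ e20)[N1 _ H1] := ycv s.
  have /cvgrPdist_lt /(_ _ e20)[N2 _ H2] := ycv t.
  have /= h1 := H1 _ (leq_maxl N1 N2); have /= h2 := H2 _ (leq_maxr N1 N2).
  have := picard_lipschitz r (maxn N1 N2) s t.
  set p := picard r _ t in h2 *; set q := picard r _ s in h1 *.
  rewrite (_ : y t - y s = (y t - p) + (p - q) + (q - y s)); last first.
    by rewrite !addrA !subrK.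
  move=> h3; rewrite (le_trans (ler_normD _ _))//.
  have := ler_normD (y t - p) (p - q); rewrite (distrC q); lra.
have t0 : 0 <= t by exact: le_trans st.
(* The first two terms replace iterate [k.+1] by the limit at [t] and at [s]; the third replaces
   iterate [k] inside [F]. *)
apply: (@le_of_geometric _ _ _ (2 * E t + 2 * E s + (t - s) * L * (2 * E s))) => k.
have h1 := picard_flow r k s0 st.
have h2 := ydist t k.+1 t0; have h3 := ydist s k.+1 s0; have h4 := ydist s k s0.
have half : 2 * E t * 2^-1 ^+ k.+1 <= 2 * E t * 2^-1 ^+ k.
  rewrite ler_wpM2l ?E20// exprS ler_piMl ?exprn_ge0 ?invr_ge0//.
  by rewrite invf_le1// ler1n.
have half' : 2 * E s * 2^-1 ^+ k.+1 <= 2 * E s * 2^-1 ^+ k.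
  rewrite ler_wpM2l ?E20// exprS ler_piMl ?exprn_ge0 ?invr_ge0//.
  by rewrite invf_le1// ler1n.
have h5 : `|(t - s) *: (F (y s) - F (picard r k s))| <= (t - s) * L * (2 * E s) * 2^-1 ^+ k.
  rewrite normrZ ger0_norm ?subr_ge0// -2!(mulrA (t - s)) ler_wpM2l ?subr_ge0//.
  rewrite (le_trans (FL _ _))// -(mulrA L) ler_wpM2l//; exact: ltW.
set p := picard r k.+1 t in h1 h2 *; set q := picard r k.+1 s in h1 h3 *.
set z := picard r k s in h1 h4 h5 *.
rewrite (_ : _ - _ = (y t - p) + (p - q - (t - s) *: F z) + (q - y s)
    - (t - s) *: (F (y s) - F z)); last first.
  by apply/matrixP => i j; rewrite !mxE; ring.
rewrite (le_trans (ler_normB _ _))// (le_trans (lerD (ler_normD _ _) (lexx _)))//.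
rewrite (le_trans (lerD (lerD (ler_normD _ _) (lexx _)) (lexx _)))//.
rewrite (mulrDl _ _ (2^-1 ^+ k)) (mulrDl _ _ (2^-1 ^+ k)).
by apply: sum4_le => //; [exact: le_trans half|rewrite distrC; exact: le_trans half'].
Qed.

End picard.

Lemma expR_affine_le1 (R : realType) (x : R) : expR (- x) * (1 + x) <= 1.
Proof.
rewrite expRN mulrC ler_pdivrMr ?expR_gt0// mul1r; exact: expR_ge1Dx.
Qed.

Lemma continuous_seg_of_continuous (R : realType) (h : R -> R) (a b : R) :
  continuous h -> continuous_seg a b h.
Proof.
move=> ch s _ e e0; have /cvgrPdist_lt /(_ e e0) /nbhs_ballP[d /= d0 hd] := ch s.
by exists d => // s' _ s's; rewrite distrC; apply: hd; rewrite -ball_normE/= distrC.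
Qed.

Lemma quadratic_small (R : realType) (K e : R) : 0 < e ->
  exists2 d : R, 0 < d & forall k, 0 <= k -> k < d -> K * k ^+ 2 <= e * k.
Proof.
move=> e0; have K1 : 0 < `|K| + 1 by rewrite ltr_wpDl.
exists (e / (`|K| + 1)) => [|k k0]; first by rewrite divr_gt0.
rewrite ltr_pdivlMr// => ke.
rewrite expr2 mulrA ler_wpM2r// (le_trans _ (ltW ke))//.
by rewrite mulrC ler_wpM2l// (le_trans (ler_norm _))// lerDl.
Qed.

(** The norm need not be differentiable, so the decrease of [expR (- (L * s)) * D s] is read off
    Dini derivatives: the forward expansions give [D (s + k) <= (1 + L * k) * D s + 2 * C * k ^+ 2],
    and the exponential absorbs the factor [1 + L * k]. *)
Lemma flow_curve_gronwall (R : realType) n (F : 'rV[R]_n -> 'rV[R]_n)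
    (L M C : R) (y z : R -> 'rV[R]_n) (t : R) :
  0 <= L -> (forall u v, `|F u - F v| <= L * `|u - v|) ->
  flow_curve F M C y -> flow_curve F M C z -> 0 <= t ->
  `|y t - z t| <= expR (L * t) * `|y 0 - z 0|.
Proof.
move=> L0 FL [yM yC] [zM zC] t0.
pose D s := `|y s - z s|.
have cD : continuous D.
  move=> s; apply: (@continuous_comp _ _ _ (y \- z) (fun v => `|v|)).
    by apply: continuousB; apply: lipschitz_bound_continuous; [exact: yM|exact: zM].
  exact: norm_continuous.
pose h s := - (expR (- (L * s)) * D s).
have ch : continuous h.
  move=> s; apply: cvgN; apply: cvgM; last exact: cD.
  apply: (@continuous_comp _ _ _ (fun s => - (L * s)) expR); last exact: continuous_expR.
  by apply: cvgN; exact: mulrl_continuous.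
have : h 0 <= h t.
  apply: dini_nondecreasing => //; first exact: continuous_seg_of_continuous.
  move=> e e0 s s0 st.
  have [d d0 hd] := quadratic_small (2 * C) e0.
  exists d => // k k0 kd _; apply: le_trans (lerD (lexx _) (hd k (ltW k0) kd)).
  suff H : expR (- (L * (s + k))) * D (s + k) <=
      expR (- (L * s)) * D s + 2 * C * k ^+ 2 by rewrite /h; clear -H; lra.
  have sk : s <= s + k by rewrite lerDl ltW.
  have Dk : D (s + k) <= (1 + L * k) * D s + 2 * C * k ^+ 2.
    have := yC _ _ s0 sk; have := zC _ _ s0 sk.
    rewrite [s + k - s]addrC addKr => hz hy.
    have -> : D (s + k) = `|(y s - z s) + k *: (F (y s) - F (z s)) +
       (y (s + k) - y s - k *: F (y s)) - (z (s + k) - z s - k *: F (z s))|.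
      by congr `|_|; apply/matrixP => i j; rewrite !mxE; ring.
    have kF : `|k *: (F (y s) - F (z s))| <= L * k * D s.
      rewrite normrZ gtr0_norm// [L * k]mulrC -mulrA.
      by apply: ler_wpM2l; [exact: ltW|exact: FL].
    rewrite (le_trans (ler_normB _ _))// (le_trans (lerD (ler_normD _ _) hz))//.
    rewrite (le_trans (lerD (lerD (ler_normD _ _) hy) (lexx _)))//.
    rewrite -/(D s) mulrDl mul1r; clear -kF; lra.
  have E1 : 0 <= expR (- (L * (s + k))) by exact: expR_ge0.
  have C0 : 0 <= 2 * C * k ^+ 2.
    have := le_trans (normr_ge0 _) (yC _ _ s0 sk).
    by rewrite [s + k - s]addrC addKr => H; rewrite -mulrA mulr_ge0.
  rewrite (le_trans (ler_wpM2l E1 Dk))// mulrDr lerD//.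
    rewrite (mulrDr L) opprD expRD mulrA; apply: ler_wpM2r; first exact: normr_ge0.
    rewrite -[leRHS]mulr1 -mulrA.
    by rewrite ler_wpM2l ?expR_ge0// expR_affine_le1.
  rewrite ler_piMl// -expR0 ler_expR oppr_le0 mulr_ge0// (le_trans s0)//.
rewrite /h mulr0 oppr0 expR0 mul1r lerN2 expRN -/(D 0) -/(D t) => H.
by rewrite -ler_pdivrMl ?expR_gt0.
Qed.

Lemma flow_curve_shift (R : realType) n (F : 'rV[R]_n -> 'rV[R]_n) (M C : R)
    (y : R -> 'rV[R]_n) (a : R) :
  0 <= a -> flow_curve F M C y -> flow_curve F M C (fun s => y (a + s)).
Proof.
move=> a0 [yM yC]; split=> [s t|s t s0 st].
  by have := yM (a + s) (a + t); rewrite opprD addrACA subrr add0r.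
have := yC (a + s) (a + t); rewrite opprD addrACA subrr add0r.
by apply; [rewrite addr_ge0|rewrite lerD2l].
Qed.

(** * First-order expansions of test functions *)

Lemma dotpDr (R : realType) n (q v w : 'rV[R]_n) :
  dotp q (v + w) = dotp q v + dotp q w.
Proof. by rewrite /dotp -big_split/=; apply: eq_bigr => i _; rewrite mxE mulrDr. Qed.

Lemma dotpDl (R : realType) n (q v w : 'rV[R]_n) :
  dotp (v + w) q = dotp v q + dotp w q.
Proof. by rewrite /dotp -big_split/=; apply: eq_bigr => i _; rewrite mxE mulrDl. Qed.

Lemma dotpZr (R : realType) n (q v : 'rV[R]_n) c : dotp q (c *: v) = c * dotp q v.
Proof. by rewrite /dotp mulr_sumr; apply: eq_bigr => i _; rewrite mxE mulrCA. Qed.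

(** The dual of the maximum norm carried by row vectors; gradients are measured with it. *)
Definition norm1 (R : realType) n (q : 'rV[R]_n) : R := \sum_i `|q 0 i|.

Lemma norm1_ge0 (R : realType) n (q : 'rV[R]_n) : 0 <= norm1 q.
Proof. exact: sumr_ge0. Qed.

Lemma dotp_le (R : realType) n (q v : 'rV[R]_n) : `|dotp q v| <= norm1 q * `|v|.
Proof.
rewrite /dotp /norm1 mulr_suml (le_trans (ler_norm_sum _ _ _))//.
by apply: ler_sum => i _; rewrite normrM ler_wpM2l// rV_coord_le.
Qed.

Section partials.
Context (R : realType) (n : nat).
Implicit Types (phi : 'rV[R]_n * R -> R) (p : 'rV[R]_n * R).

(** [C1_on] speaks of directional derivatives in the product space, the equation of derivatives
    along slices; this lemma and the next one identify them. *)
Lemma derive_slice_state phi p v :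
  'D_((v, 0) : 'rV[R]_n * R) phi p = 'D_v (fun x => phi (x, p.2)) p.1.
Proof.
rewrite /derive; apply: (congr1 (fun F : R -> R => lim (F @ 0^'))).
apply/funext => h /=.
congr (_ *: (phi _ - _)); last by case: p.
by case: p => x t; congr (_, _) => /=; rewrite scaler0 add0r.
Qed.

Lemma derive_slice_time phi p :
  'D_((0, 1) : 'rV[R]_n * R) phi p = partial_t phi p.
Proof.
rewrite /partial_t derive1E /derive; apply: (congr1 (fun F : R -> R => lim (F @ 0^'))).
apply/funext => h /=.
congr (_ *: (phi _ - _)); last by case: p.
by case: p => x t; congr (_, _) => /=; rewrite scaler0 add0r.
Qed.

Lemma diff_grad phi p (w : 'rV[R]_n) (s : R) : differentiable phi p ->
  'd phi p (w, s) = dotp (grad_r phi p) w + s * partial_t phi p.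
Proof.
move=> dphi.
have -> : (w, s) = (\sum_i w 0 i *: ((delta_mx 0 i, 0) : 'rV[R]_n * R)) +
    s *: ((0, 1) : 'rV[R]_n * R).
  apply/eqP; rewrite -pair_eqE; apply/andP; split; apply/eqP => /=.
    rewrite scaler0 addr0 [LHS]row_sum_delta.
    by rewrite (big_morph fst (id1 := 0) (op1 := +%R)).
  rewrite (big_morph snd (id1 := 0) (op1 := +%R))//=.
  by rewrite big1 ?add0r ?[_ *: _]mulr1// => i _; rewrite scaler0.
rewrite linearD linearZ/= linear_sum/=; congr (_ + _); last first.
  by rewrite -derive_slice_time deriveE.
apply: eq_bigr => i _; rewrite linearZ/= mulrC; congr (_ * _).
by rewrite mxE -deriveE// derive_slice_state.
Qed.

Lemma differentiable_bound phi p e : differentiable phi p -> 0 < e ->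
  exists2 d : R, 0 < d & forall w s, `|w| < d -> `|s| < d ->
    `|phi (p.1 + w, p.2 + s) - phi p - (dotp (grad_r phi p) w + s * partial_t phi p)|
      <= e * (`|w| + `|s|).
Proof.
move=> dphi e0; have /eqaddoP/(_ e e0)/= := diff_locally dphi.
move=> /nbhs_ballP[d /= d0 dH]; exists d => // w s wd sd.
have /= := dH (w, s); rewrite -ball_normE/= => H.
rewrite -diff_grad// -[phi (_, _)](_ : phi ((w, s) + p) = _); last first.
  by congr phi; case: p {dphi dH H} => x t; congr (_, _) => /=; rewrite addrC.
rewrite -addrA -opprD; apply: le_trans (H _) _.
  by rewrite sub0r normrN prod_normE/= gt_max wd.
rewrite ler_wpM2l ?(ltW e0)// prod_normE/= ge_max.
by rewrite lerDl lerDr !normr_ge0.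
Qed.

(** The second variable is the time to go, so it decreases while the state advances. Half of [e]
    covers the remainder of [phi], the other half the quadratic deviation of [z] from its
    tangent. *)
Lemma chain_flow phi (x v : 'rV[R]_n) (t C : R) (z : R -> 'rV[R]_n) e :
  differentiable phi (x, t) ->
  (forall k, 0 <= k -> `|z k - x - k *: v| <= C * k ^+ 2) -> 0 < e ->
  exists2 d : R, 0 < d & forall k, 0 < k -> k < d ->
    `|phi (z k, t - k) - phi (x, t) -
      k * (dotp (grad_r phi (x, t)) v - partial_t phi (x, t))| <= e * k.
Proof.
move=> dphi zC e0.
pose q := grad_r phi (x, t); pose B := `|v| + 1.
have B0 : 0 < B by rewrite ltr_wpDl.
have C0 : 0 <= C by have := zC 1 ler01; rewrite expr1n mulr1; apply: le_trans.
have e10 : 0 < e / 2 / (B + 1) by rewrite !divr_gt0// addr_gt0.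
have [d1 d10 H1] := differentiable_bound dphi e10.
have N1 : 0 < norm1 q + 1 by rewrite ltr_wpDl ?norm1_ge0.
have [d2 d20 H2] := quadratic_small C (ltr01 : 0 < (1 : R)).
have e20 : 0 < e / 2 / (norm1 q + 1) by rewrite !divr_gt0.
have [d3 d30 H3] := quadratic_small C e20.
exists (Num.min (Num.min d2 d3) (Num.min d1 (d1 / B))).
  by rewrite !lt_min d20 d30 d10 divr_gt0.
move=> k k0; rewrite !lt_min -andbA => /and4P[kd2 kd3 kd1].
rewrite ltr_pdivlMr// => kB.
have zx : `|z k - x| <= k * B.
  rewrite -(subrK (k *: v) (z k - x)) (le_trans (ler_normD _ _))//.
  rewrite normrZ gtr0_norm// /B mulrDr mulr1 addrC lerD2l.
  rewrite (le_trans (zC _ (ltW k0)))// (le_trans (H2 _ (ltW k0) kd2))//.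
  by rewrite mul1r.
have /= := H1 (z k - x) (- k) (le_lt_trans zx kB).
rewrite normrN gtr0_norm// => /(_ kd1); rewrite subrKC => h1.
have h2 : `|dotp q (z k - x - k *: v)| <= e / 2 * k.
  rewrite (le_trans (dotp_le _ _))//.
  rewrite (le_trans (ler_wpM2l (norm1_ge0 _) (zC _ (ltW k0))))//.
  rewrite (le_trans (ler_wpM2l (norm1_ge0 _) (H3 _ (ltW k0) kd3)))//.
  rewrite mulrA; apply: ler_wpM2r; first exact: ltW.
  rewrite mulrCA; apply: ler_piMr; first by rewrite divr_ge0 ?(ltW e0).
  by rewrite ler_pdivrMr// mul1r lerDl.
have h3 : e / 2 / (B + 1) * (`|z k - x| + k) <= e / 2 * k.
  rewrite (le_trans (ler_wpM2l (ltW e10) (lerD zx (lexx k))))//.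
  by rewrite le_eqVlt; apply/orP; left; apply/eqP; field; rewrite gt_eqF// addr_gt0.
have -> : phi (z k, t - k) - phi (x, t) - k * (dotp q v - partial_t phi (x, t)) =
  (phi (z k, t - k) - phi (x, t) - (dotp q (z k - x) + - k * partial_t phi (x, t))) +
  dotp q (z k - x - k *: v).
  by rewrite [dotp q (_ + - (k *: v))]dotpDr -(scaleNr k v) dotpZr; ring.
rewrite (le_trans (ler_normD _ _))// [e]splitr mulrDl lerD//.
exact: le_trans h1 h3.
Qed.

End partials.

(** * The value of piecewise constant controls *)

Section schedules.
Context (R : realType) (T : Type) (U : set T) (f : state R -> T -> state R)
  (L M K : R) (g nu : state R -> R) (Phi : T -> state R -> R -> state R) (u0 : T).
Hypotheses (L0 : 0 < L) (Uu0 : U u0)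
  (fL : forall x y u, U u -> `|f x u - f y u| <= L * `|x - y|)
  (fM : forall x u, U u -> `|f x u| <= M)
  (gK : forall x y, `|g x - g y| <= K * `|x - y|)
  (nuK : forall x y, `|nu x - nu y| <= K * `|x - y|)
  (Phi0 : forall u r, U u -> Phi u r 0 = r)
  (PhiF : forall u r, U u -> flow_curve (f ^~ u) M (L * M) (Phi u r)).

Fixpoint schedule (t : R) (l : seq (T * R)) : Prop :=
  if l is (u, h) :: l' then [/\ U u, 0 <= h & schedule (t - h) l'] else t = 0.

(* The cost of a schedule enters only through its upper bounds [c], which avoids
   suprema of [g] along the arcs. *)
Fixpoint cost_le (c : R) (r : state R) (l : seq (T * R)) : Prop :=
  if l is (u, h) :: l' then
    (forall s, 0 <= s <= h -> g (Phi u r s) <= c) /\ cost_le c (Phi u r h) l'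
  else nu r <= c /\ g r <= c.

Definition schedule_value (p : state R * R) : R :=
  inf [set c | exists2 l, schedule p.2 l & cost_le c p.1 l].

Local Notation V := schedule_value.

Lemma schedule_bound_ge0 : 0 <= M.
Proof. exact: le_trans (fM 0 Uu0). Qed.

Lemma schedule_lip_ge0 : 0 <= K.
Proof.
have := gK (const_mx 1) 0; rewrite subr0.
have -> : `|const_mx 1 : state R| = 1.
  apply/eqP; rewrite eq_le rV_norm_le// => [|i]; last by rewrite mxE normr1.
  by rewrite -[leLHS](normr1 R); have := rV_coord_le (const_mx 1 : state R) ord0; rewrite mxE.
by rewrite mulr1; apply: le_trans.
Qed.

Let M0 := schedule_bound_ge0.
Let K0 := schedule_lip_ge0.

(** Both sides are flow curves in [s] from the same point, so the Gronwall bound makes them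
    equal. *)
Lemma flow_semigroup u r a s : U u -> 0 <= a -> 0 <= s ->
  Phi u (Phi u r a) s = Phi u r (a + s).
Proof.
move=> Uu a0 s0; apply/subr0_eq/eqP; rewrite -normr_le0.
have := flow_curve_gronwall (ltW L0) (fun x y => fL x y Uu) (PhiF (Phi u r a) Uu)
  (flow_curve_shift a0 (PhiF r Uu)) s0.
by rewrite Phi0// addr0 subrr normr0 mulr0.
Qed.

Lemma flow_lipschitz_init u x y s : U u -> 0 <= s ->
  `|Phi u x s - Phi u y s| <= expR (L * s) * `|x - y|.
Proof.
move=> Uu s0; have := flow_curve_gronwall (ltW L0) (fun x y => fL x y Uu)
  (PhiF x Uu) (PhiF y Uu) s0.
by rewrite !Phi0.
Qed.

Lemma flow_dist u r s : U u -> 0 <= s -> `|Phi u r s - r| <= M * s.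
Proof.
by move=> Uu s0; have [/(_ 0 s) + _] := PhiF r Uu; rewrite Phi0// subr0 ger0_norm.
Qed.

Lemma schedule_ge0 t l : schedule t l -> 0 <= t.
Proof.
elim: l t => [t /= ->//|[u h] l IH t /= [_ h0 /IH]].
by rewrite subr_ge0; exact: le_trans.
Qed.

Lemma cost_le_mono c c' r l : c <= c' -> cost_le c r l -> cost_le c' r l.
Proof.
move=> cc'; elim: l r => [r /= [? ?]|[u h] l IH r /= [H1 H2]].
  by split; exact: le_trans cc'.
by split; [move=> s /H1 /le_trans; apply|exact: IH].
Qed.

Lemma cost_le_obstacle c t r l : schedule t l -> cost_le c r l -> g r <= c.
Proof.
case: l => [_ []//|[u h] l /= [Uu h0 _] [+ _]].
by move=> /(_ 0); rewrite lexx h0 Phi0//; apply.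
Qed.

Lemma schedule_value_le c r t l : schedule t l -> cost_le c r l -> V (r, t) <= c.
Proof.
move=> tl cl; apply: ge_inf; last by exists l.
by exists (g r) => c' [l' /= tl' cl']; exact: cost_le_obstacle tl' cl'.
Qed.

Lemma schedule_value_nonempty r t : 0 <= t ->
  [set c | exists2 l, schedule t l & cost_le c r l] !=set0.
Proof.
move=> t0.
exists (Num.max (Num.max (nu (Phi u0 r t)) (g (Phi u0 r t))) (g r + K * (M * t))).
exists [:: (u0, t)] => /=; first by split => //; rewrite subrr.
split; last by split; rewrite !le_max lexx ?orbT.
move=> s /andP[s0 st]; rewrite le_max; apply/orP; right.
have := le_trans (ler_norm _) (gK (Phi u0 r s) r); rewrite lerBlDl.
move/le_trans; apply; rewrite lerD2l ler_wpM2l//.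
by rewrite (le_trans (flow_dist _ _ _))// ler_wpM2l.
Qed.

Lemma schedule_value_ge a r t : 0 <= t ->
  (forall l c, schedule t l -> cost_le c r l -> a <= c) -> a <= V (r, t).
Proof.
move=> t0 H; apply: lb_le_inf; first exact: schedule_value_nonempty.
by move=> c [l tl cl]; exact: H tl cl.
Qed.

Lemma schedule_value_adherent r t e : 0 <= t -> 0 < e ->
  exists l c, [/\ schedule t l, cost_le c r l & c < V (r, t) + e].
Proof.
move=> t0 e0; have [|c [l tl cl] ce] := @inf_adherent _
  [set c | exists2 l, schedule t l & cost_le c r l] _ e0; last by exists l, c.
split; first exact: schedule_value_nonempty.
by exists (g r) => c' [l' /= tl' cl']; exact: cost_le_obstacle tl' cl'.
Qed.

Lemma schedule_value_obstacle r t : 0 <= t -> g r <= V (r, t).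
Proof.
by move=> t0; apply: schedule_value_ge => // l c; exact: cost_le_obstacle.
Qed.

Lemma schedule_value0 r : V (r, 0) = Num.max (nu r) (g r).
Proof.
apply/eqP; rewrite eq_le; apply/andP; split.
  by apply: (@schedule_value_le _ _ _ [::]) => //=; rewrite !le_max !lexx orbT.
apply: schedule_value_ge => // l c l0 cl; rewrite ge_max.
(* A schedule of total time 0 may still list arcs of length 0. *)
elim: l l0 cl => [_ /= [-> ->]//|[u h] l IH /= [Uu h0 hl] [_ cl]].
have hE : h = 0 by apply/eqP; rewrite eq_le h0 andbT -oppr_ge0 -[- h]add0r (schedule_ge0 hl).
by apply: IH; [move: hl|move: cl]; rewrite hE ?subr0// Phi0.
Qed.

Lemma schedule_value_dpp c u r t h : U u -> 0 <= t -> 0 <= h ->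
  (forall s, 0 <= s <= h -> g (Phi u r s) <= c) -> V (Phi u r h, t) <= c ->
  V (r, t + h) <= c.
Proof.
move=> Uu t0 h0 gc Vc; apply/ler_addgt0Pr => e e0.
have [l [c' [tl cl ce]]] := schedule_value_adherent (Phi u r h) t0 e0.
have cc : c <= c + e by rewrite lerDl ltW.
apply: (@schedule_value_le _ _ _ ((u, h) :: l)) => /=; first by rewrite addrK.
split; first by move=> s /gc /le_trans; apply.
by apply: cost_le_mono cl; rewrite (le_trans (ltW ce))// lerD2r.
Qed.

(** The same schedule is run from [r']. The growth [expR (L * h)] over the first arc and
    [expR (L * (t - h))] over the rest multiply to [expR (L * t)], whatever the number of arcs. *)
Lemma cost_le_lipschitz c r r' t l : schedule t l -> cost_le c r l ->
  cost_le (c + K * (expR (L * t) * `|r - r'|)) r' l.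
Proof.
have lip (q : state R -> R) a b B : (forall x y, `|q x - q y| <= K * `|x - y|) -> q a <= c ->
    `|a - b| <= B -> q b <= c + K * B.
  move=> qK qa ab; have := le_trans (ler_norm _) (qK b a); rewrite lerBlDr distrC => H.
  by rewrite (le_trans H)// addrC lerD// ler_wpM2l.
elim: l r r' t => [r r' t /= -> [nc gc]|[u h] l IH r r' t /= [Uu h0 tl] [gc cl]].
  by rewrite mulr0 expR0 mul1r; split; [apply: lip nuK nc _|apply: lip gK gc _].
split=> [s /andP[s0 sh]|].
  apply: (lip _ _ _ _ gK (gc s _)); first by rewrite s0.
  rewrite (le_trans (flow_lipschitz_init _ _ Uu s0))// ler_wpM2r// ler_expR.
  rewrite ler_wpM2l ?(le_trans sh) ?(ltW L0)//.
  by rewrite -subr_ge0 (schedule_ge0 tl).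
apply: (cost_le_mono _ (IH _ (Phi u r' h) _ tl cl)).
rewrite lerD2l ler_wpM2l//.
rewrite (le_trans (ler_wpM2l (expR_ge0 _) (flow_lipschitz_init _ _ Uu h0)))//.
by rewrite mulrA -expRD -mulrDr subrK.
Qed.

Lemma schedule_value_lipschitz_state r r' t : 0 <= t ->
  V (r', t) <= V (r, t) + K * (expR (L * t) * `|r - r'|).
Proof.
move=> t0; apply/ler_addgt0Pr => e e0.
have [l [c [tl cl ce]]] := schedule_value_adherent r t0 e0.
rewrite (le_trans (schedule_value_le tl (cost_le_lipschitz r' tl cl)))//.
by rewrite addrAC lerD2r ltW.
Qed.

(* Any invariant [Q] of the flows holds at the point that a schedule reaches
   after the elapsed time [h]. *)
Lemma cost_le_split (Q : state R -> R -> Prop) c t h :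
  0 <= t ->
  (forall u x s k, U u -> 0 <= k -> s + k <= h -> Q x s -> Q (Phi u x k) (s + k)) ->
  forall l r s, s <= h -> Q r s -> schedule (t + (h - s)) l -> cost_le c r l ->
  exists2 x, Q x h & V (x, t) <= c.
Proof.
move=> t0 Qstep; elim=> [|[u k] l IH] r s sh Qr.
  move=> /= th [nc gc].
  have [tE hE] : t = 0 /\ h = s by split; lra.
  exists r; first by rewrite hE.
  by rewrite tE schedule_value0 ge_max nc.
move=> [Uu k0 hl] [gc cl].
have [skh|hsk] := leP (s + k) h.
  apply: (IH (Phi u r k) (s + k)) => //; first exact: Qstep.
  by move: hl; rewrite opprD !addrA.
(* The current arc passes beyond time [h]: it is cut there, and its remainder starts the new
   schedule. *)
exists (Phi u r (h - s)).
  rewrite -[X in Q _ X](subrKC s); apply: Qstep => //; first by rewrite subr_ge0.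
  by rewrite subrKC.
have hs0 : 0 <= h - s by rewrite subr_ge0.
apply: (@schedule_value_le _ _ _ ((u, k - (h - s)) :: l)) => /=.
  split => //; first lra.
  by rewrite (_ : t - (k - (h - s)) = t + (h - s) - k)//; ring.
split=> [s' /andP[s'0 s'k]|].
  by rewrite flow_semigroup//; apply: gc; lra.
by rewrite flow_semigroup ?subrKC//; lra.
Qed.

(** An initial arc of length [h] with control [u0] moves the state by at most [M * h], which the
    Lipschitz bound in the state absorbs. *)
Lemma schedule_value_time_le r t h : 0 <= t -> 0 <= h ->
  V (r, t + h) <= V (r, t) + K * (expR (L * t) * (M * h)).
Proof.
move=> t0 h0.
have E1 : 1 <= expR (L * t) by rewrite -expR0 ler_expR mulr_ge0// ltW.
apply: (schedule_value_dpp Uu0) => // [s /andP[s0 sh]|].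
  have := le_trans (ler_norm _) (gK (Phi u0 r s) r); rewrite lerBlDl.
  move/le_trans; apply; rewrite lerD ?schedule_value_obstacle// ler_wpM2l//.
  rewrite (le_trans (flow_dist _ _ _))// (le_trans (ler_wpM2l M0 sh))//.
  by rewrite ler_peMl// mulr_ge0.
apply: le_trans (schedule_value_lipschitz_state r _ t0) _.
by rewrite lerD2l ler_wpM2l// ler_wpM2l ?expR_ge0// distrC flow_dist.
Qed.

(** Conversely, the first [h] units of time of a nearly optimal schedule are dropped; the point
    reached is within [M * h] of [r]. *)
Lemma schedule_value_time_ge r t h : 0 <= t -> 0 <= h ->
  V (r, t) <= V (r, t + h) + K * (expR (L * t) * (M * h)).
Proof.
move=> t0 h0; apply/ler_addgt0Pr => e e0.
have th0 : 0 <= t + h by exact: addr_ge0.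
have [l [c [tl cl ce]]] := schedule_value_adherent r th0 e0.
have [|||||x xr Vx] := @cost_le_split (fun x s => `|x - r| <= M * s) c t h t0 _ l r 0.
- move=> u x s k Uu k0 _ xr; rewrite -(subrKA x) (le_trans (ler_normD _ _))//.
  by rewrite mulrDr addrC lerD// flow_dist.
- by [].
- by rewrite subrr normr0 mulr0.
- by rewrite subr0.
- exact: cl.
rewrite (le_trans (schedule_value_lipschitz_state x _ t0))//.
rewrite addrAC lerD//; first by rewrite (le_trans Vx)// ltW.
by rewrite ler_wpM2l// ler_wpM2l ?expR_ge0.
Qed.

Lemma schedule_value_lipschitz B r r' t t' : 0 <= t <= B -> 0 <= t' <= B ->
  `|V (r, t) - V (r', t')| <= K * expR (L * B) * (`|r - r'| + M * `|t - t'|).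
Proof.
have EB s : s <= B -> expR (L * s) <= expR (L * B).
  by move=> sB; rewrite ler_expR ler_wpM2l// ltW.
have time x a b : 0 <= a -> a <= b -> b <= B ->
    `|V (x, a) - V (x, b)| <= K * (expR (L * B) * (M * (b - a))).
  move=> a0 ab bB; have ba0 : 0 <= b - a by rewrite subr_ge0.
  have := schedule_value_time_le x a0 ba0; have := schedule_value_time_ge x a0 ba0.
  rewrite subrKC => h1 h2.
  have : K * (expR (L * a) * (M * (b - a))) <= K * (expR (L * B) * (M * (b - a))).
    rewrite ler_wpM2l// ler_wpM2r ?mulr_ge0// EB// (le_trans ab)//.
  by rewrite ler_norml; lra.
have time' x a b : 0 <= a <= B -> 0 <= b <= B ->
    `|V (x, a) - V (x, b)| <= K * (expR (L * B) * (M * `|a - b|)).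
  move=> /andP[a0 aB] /andP[b0 bB]; have [ab|ba] := leP a b.
    by rewrite [`|a - b|]distrC [`|b - a|]ger0_norm ?subr_ge0// time.
  rewrite distrC [`|a - b|]gtr0_norm ?subr_gt0//; apply: time => //.
  exact: ltW.
move=> tB t'B; have := time' r' t t' tB t'B.
have /andP[t0 tB'] := tB.
have h1 := schedule_value_lipschitz_state r r' t0.
have h2 := schedule_value_lipschitz_state r' r t0.
rewrite (distrC r') in h2.
have h3 : K * (expR (L * t) * `|r - r'|) <= K * (expR (L * B) * `|r - r'|).
  by rewrite ler_wpM2l// ler_wpM2r// EB.
rewrite mulrDr -!mulrA !ler_norml; lra.
Qed.

Lemma schedule_value_continuous : {within [set p | 0 <= p.2], continuous V}.
Proof.
apply/subspace_continuousP => -[r t] /= t0; apply/cvgrPdist_lt => e e0.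
pose A := K * expR (L * (t + 1)) * (1 + M) + 1.
have A0 : 0 < A by rewrite ltr_wpDl// mulr_ge0 ?mulr_ge0 ?expR_ge0// addr_ge0.
pose d := Num.min 1 (e / A).
have d0 : 0 < d by rewrite lt_min ltr01 divr_gt0.
have d1 : d <= 1 by rewrite ge_min lexx.
have dA : d * A <= e by rewrite -ler_pdivlMr// ge_min lexx orbT.
have := nbhsx_ballx (r, t) _ d0; rewrite /within/=.
apply: filterS => -[r' t'] [/=]; rewrite -!ball_normE/= => rr' tt' t'0.
have tt'' : `|t - t'| <= 1 by rewrite (le_trans (ltW tt')).
rewrite (le_lt_trans (@schedule_value_lipschitz (t + 1) _ _ _ _ _ _))//.
- by apply/andP; split; [exact: t0|rewrite lerDl].
- apply/andP; split; first exact: t'0.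
  by move: tt''; rewrite ler_norml; lra.
rewrite (lt_le_trans _ dA)//.
apply: (@le_lt_trans _ _ (K * expR (L * (t + 1)) * (d + M * d))).
  by rewrite ler_wpM2l ?mulr_ge0 ?expR_ge0// lerD ?ler_wpM2l// ltW.
rewrite (_ : d * A = K * expR (L * (t + 1)) * (d + M * d) + d); last first.
  by rewrite /A; ring.
by rewrite ltrDl.
Qed.

(** * Viscosity properties of the value of schedules *)

Local Notation HU := (fun r q : state R => - inf [set dotp q (f r u) | u in U]).

Lemma drift_set_lbound q r :
  has_lbound [set dotp q (f r u) | u in U].
Proof.
exists (- (norm1 q * M)) => _ [u Uu <-].
rewrite lerNl (le_trans (ler_norm _))// normrN (le_trans (dotp_le _ _))//.
by rewrite ler_wpM2l ?norm1_ge0// fM.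
Qed.

(** The asymmetric form is the one met after doubling variables: the two test functions share the
    gradient [q] of the penalty, and only one of them carries the extra gradient [z] of the
    barrier. *)
Lemma drift_hamiltonian_lipschitz (r r' q z : state R) :
  HU r' q - HU r (q + z) <= norm1 q * (L * `|r' - r|) + norm1 z * M.
Proof.
rewrite opprK addrC -lerBrDr opprK -lerBlDl.
apply: lb_le_inf; first by exists (dotp q (f r' u0)), u0.
move=> _ [u Uu <-]; rewrite lerBlDl.
have : inf [set dotp (q + z) (f r u) | u in U] <= dotp (q + z) (f r u).
  by apply: ge_inf; [exact: drift_set_lbound|exists u].
move/le_trans; apply; rewrite dotpDl addrAC; apply: lerD.
  rewrite addrC -lerBlDl -(subrKC (f r' u) (f r u)) dotpDr addrAC subrr add0r.
  rewrite (le_trans (ler_norm _))// (le_trans (dotp_le _ _))//.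
  by rewrite ler_wpM2l ?norm1_ge0// distrC fL.
rewrite (le_trans (ler_norm _))// (le_trans (dotp_le _ _))//.
by rewrite ler_wpM2l ?norm1_ge0// fM.
Qed.

Lemma flow_quadratic u r k : U u -> 0 <= k ->
  `|Phi u r k - r - k *: f r u| <= L * M * k ^+ 2.
Proof.
move=> Uu k0; have [_ /(_ 0 k (lexx 0) k0)] := PhiF r Uu.
by rewrite Phi0// subr0.
Qed.

(** If both terms of the minimum were positive, some constant control would make [phi], and with it
    [V], drop by at least [k * d] along a short arc on which [g] stays below [V (r, t) - k * d].
    Prefixing that arc would give [V (r, t) <= V (r, t) - k * d]. *)
Lemma schedule_value_subsolution phi p :
  C1_on [set q : state R * R | 0 < q.2] phi -> 0 < p.2 ->
  local_max (fun x => V x - phi x) p -> qvi_operator HU g V phi p <= 0.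
Proof.
case: p => r t C1 /= t0 lmax.
have [dphi _] := C1 (r, t) t0.
rewrite /qvi_operator ge_min leNgt [X in _ || X]leNgt -negb_and; apply/negP.
rewrite /= subr_gt0 subr_gt0 => /andP[gV].
set q := grad_r phi (r, t); set pt := partial_t phi (r, t) => Hpt.
have [u Uu qf] : exists2 u, U u & dotp q (f r u) < pt.
  apply: contrapT => H; move: Hpt; rewrite ltNge => /negP; apply.
  apply: lb_le_inf; first by exists (dotp q (f r u0)), u0.
  by move=> _ [u Uu <-]; rewrite leNgt; apply/negP => ?; apply: H; exists u.
pose d : R := (pt - dotp q (f r u)) / 2.
have d0 : 0 < d by rewrite divr_gt0// subr_gt0.
have [k1 k10 H1] := chain_flow dphi (fun k => flow_quadratic r Uu) d0.
move: lmax; rewrite /local_max => /nbhs_ballP[e /= e0 He].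
(* [B] gathers every rate at once: [K * M] for [g] along the arc, [d] for the drop of the value, [M]
   and 1 for the displacement in state and time. *)
pose B : R := K * M + d + M + 1.
have B0 : 0 < B.
  by rewrite ltr_wpDl// addr_ge0// addr_ge0 ?(ltW d0)// mulr_ge0.
pose m : R := Num.min (Num.min k1 (V (r, t) - g r)) (Num.min e t).
have m0 : 0 < m by rewrite !lt_min k10 subr_gt0 gV e0 t0.
pose k : R := m / (2 * (B + 1)).
have BB : 0 < 2 * (B + 1) by rewrite mulr_gt0// addr_gt0.
have k0 : 0 < k by rewrite divr_gt0.
have kB : k * (B + 1) < m.
  rewrite (_ : k * (B + 1) = m / 2); last by rewrite /k; field; rewrite gt_eqF// addr_gt0.
  by rewrite ltr_pdivrMr// ltr_pMr// ltr1n.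
move: kB; rewrite /m !lt_min -andbA => /and4P[kk1 kV ke kt].
have kM : 0 <= k * M by rewrite mulr_ge0// ltW.
have kd : 0 < k * d by rewrite mulr_gt0.
have kKM : 0 <= k * (K * M) by rewrite mulr_ge0 ?(mulr_ge0 K0 M0)// ltW.
have kBE : k * (B + 1) = k * (K * M) + k * d + k * M + k + k by rewrite /B; ring.
rewrite {}kBE in kk1 kV ke kt.
have kk1' : k < k1 by lra.
have := H1 k k0 kk1'; rewrite -/q -/pt.
have -> : k * (dotp q (f r u) - pt) = - (2 * (k * d)) by rewrite /d; field.
rewrite ler_norml => /andP[_ h1].
have h2 : V (Phi u r k, t - k) - phi (Phi u r k, t - k) <= V (r, t) - phi (r, t).
  apply: He; rewrite -ball_normE/= prod_normE/= gt_max; apply/andP; split.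
    by rewrite distrC (le_lt_trans (flow_dist _ Uu (ltW k0)))// mulrC; lra.
  by rewrite subKr gtr0_norm//; lra.
have tk0 : 0 <= t - k by lra.
have := @schedule_value_dpp (V (r, t) - k * d) u r (t - k) k Uu tk0 (ltW k0) _ _.
rewrite subrK => H.
suff : V (r, t) <= V (r, t) - k * d by lra.
apply: H; last by lra.
move=> s /andP[s0 sk].
have := le_trans (ler_norm _) (gK (Phi u r s) r); rewrite lerBlDl => h3.
have : K * `|Phi u r s - r| <= k * (K * M).
  rewrite mulrCA ler_wpM2l// (le_trans (flow_dist _ Uu s0))// mulrC ler_wpM2r//.
by lra.
Qed.

Lemma dotp_drift_perturb (q q' r r' : state R) u (eta : R) : U u -> 0 <= eta ->
  (forall i, `|q' 0 i - q 0 i| <= eta) -> `|r' - r| <= eta ->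
  dotp q (f r u) - eta * (7 * M + norm1 q * L) <= dotp q' (f r' u).
Proof.
move=> Uu eta0 qq' rr'.
have -> : dotp q' (f r' u) = dotp q (f r u) + dotp q (f r' u - f r u) + dotp (q' - q) (f r' u).
  by rewrite -dotpDr subrKC -dotpDl subrKC.
have h1 := le_trans (dotp_le q (f r' u - f r u))
  (ler_wpM2l (norm1_ge0 _) (le_trans (fL r' r Uu) (ler_wpM2l (ltW L0) rr'))).
have n7 : norm1 (q' - q) <= 7 * eta.
  apply: (@le_trans _ _ (\sum_(i < 7) eta)).
    by apply: ler_sum => i _; rewrite !mxE.
  by rewrite sumr_const card_ord mulr_natl.
have h2 := le_trans (dotp_le (q' - q) (f r' u))
  (ler_pM (norm1_ge0 _) (normr_ge0 _) n7 (fM r' Uu)).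
move: h1 h2; rewrite !ler_norml => /andP[h1 _] /andP[h2 _].
have -> : eta * (7 * M + norm1 q * L) = 7 * eta * M + norm1 q * (L * eta) by ring.
by lra.
Qed.

(** A schedule may switch arbitrarily often, so one neighbourhood must serve all controls. It exists
    because the error in [dotp_drift_perturb] does not depend on [u]. *)
Lemma drift_lower_bound_near phi r t d :
  C1_on [set q : state R * R | 0 < q.2] phi -> 0 < t -> 0 < d ->
  (forall u, U u -> 2 * d <=
     dotp (grad_r phi (r, t)) (f r u) - partial_t phi (r, t)) ->
  \forall p \near (r, t), forall u, U u ->
     d <= dotp (grad_r phi p) (f p.1 u) - partial_t phi p.
Proof.
move=> C1 t0 d0 Hd.
have [dphi cphi] := C1 (r, t) t0.
set q := grad_r phi (r, t) in Hd *.
(* Of the final 2, one [eta] pays for the change of the time derivative and the other is slack. *)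
pose B : R := 7 * M + norm1 q * L + 2.
have B0 : 0 < B.
  by rewrite ltr_wpDl// addr_ge0// mulr_ge0 ?norm1_ge0 ?(ltW L0).
pose eta : R := d / B.
have eta0 : 0 < eta by rewrite divr_gt0.
have near_grad i : \forall p \near (r, t), `|grad_r phi p 0 i - q 0 i| <= eta.
  have /cvgrPdist_le /(_ _ eta0) := cphi (delta_mx 0 i, 0).
  by apply: filterS => p; rewrite distrC !derive_slice_state !mxE.
have near_t : \forall p \near (r, t), `|partial_t phi p - partial_t phi (r, t)| <= eta.
  have /cvgrPdist_le /(_ _ eta0) := cphi (0, 1).
  by apply: filterS => p; rewrite distrC !derive_slice_time.
have near_r : \forall p \near (r, t), `|p.1 - r| <= eta.
  have := nbhsx_ballx (r, t) _ eta0; apply: filterS => p [/= h _].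
  by move: h; rewrite -ball_normE/= distrC => /ltW.
have near_q := filter_forall (nbhs_filter _) near_grad.
apply: filterS3 near_q near_t near_r => -[x s] /= h1 h2 h3 u Uu.
have := dotp_drift_perturb Uu (ltW eta0) h1 h3.
have := Hd u Uu; move: h2; rewrite ler_norml => /andP[_].
have : eta * (7 * M + norm1 q * L) + eta + eta = d.
  rewrite (_ : _ + _ = eta * B); last by rewrite /B; ring.
  by rewrite /eta divfK ?gt_eqF.
by lra.
Qed.

(** If the Hamiltonian term were negative, [phi] would grow at rate at least [d] along every
    schedule near [(r, t)]. By local minimality [V] would gain [d * h] in time [h], whereas along a
    nearly optimal schedule it stays below [V (r, t) + d * h]. *)
Lemma schedule_value_supersolution phi p :
  C1_on [set q : state R * R | 0 < q.2] phi -> 0 < p.2 ->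
  local_min (fun x => V x - phi x) p -> 0 <= qvi_operator HU g V phi p.
Proof.
case: p => r t C1 /= t0 lmin.
rewrite /qvi_operator le_min/= subr_ge0 (schedule_value_obstacle _ (ltW t0))/=.
set q := grad_r phi (r, t); set pt := partial_t phi (r, t).
rewrite subr_ge0 leNgt; apply/negP => Hpt.
pose d : R := (inf [set dotp q (f r u) | u in U] - pt) / 2.
have d0 : 0 < d by rewrite divr_gt0// subr_gt0.
have Hd u : U u -> 2 * d <= dotp q (f r u) - pt.
  move=> Uu; rewrite /d mulrC divfK// lerD2r.
  by apply: ge_inf; [exact: drift_set_lbound|exists u].
have near_t : \forall p \near (r, t), 0 < p.2.
  have := nbhsx_ballx (r, t) _ t0; apply: filterS => p [/= _].
  by rewrite -ball_normE/= ltr_norml; lra.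
have [rho rho0 Hrho] : exists2 rho : R, 0 < rho & forall p, ball (r, t) rho p ->
    [/\ 0 < p.2, forall u, U u ->
        d <= dotp (grad_r phi p) (f p.1 u) - partial_t phi p
      & V (r, t) - phi (r, t) <= V p - phi p].
  have /nbhs_ballP[a /= a0 Ha] := near_t.
  have /nbhs_ballP[b /= b0 Hb] := drift_lower_bound_near C1 t0 d0 Hd.
  have /nbhs_ballP[c /= c0 Hc] := lmin.
  exists (Num.min a (Num.min b c)); first by rewrite !lt_min a0 b0.
  move=> p Hp; split.
  - by apply: Ha; apply: le_ball Hp; rewrite ge_min lexx.
  - by apply: Hb; apply: le_ball Hp; rewrite !ge_min lexx !orbT.
  - by apply: Hc; apply: le_ball Hp; rewrite !ge_min lexx !orbT.
(* Speed at most [M] then keeps every arc up to time [h] inside the ball of radius [rho], and the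
   time to go stays positive. *)
pose h : R := Num.min (rho / (2 * (M + 1))) (t / 2).
have M1 : 0 < M + 1 by rewrite ltr_wpDl.
have h0 : 0 < h by rewrite lt_min !divr_gt0// mulr_gt0.
have ht : h < t by rewrite gt_min; apply/orP; right; lra.
have hrho : h * (M + 1) < rho.
  apply: (@le_lt_trans _ _ (rho / (2 * (M + 1)) * (M + 1))).
    by rewrite ler_wpM2r ?(ltW M1)// ge_min lexx.
  rewrite invfM mulrA divfK ?gt_eqF//; lra.
have hM : 0 <= h * M by rewrite mulr_ge0 ?(ltW h0).
have near_pt x s : 0 <= s -> s <= h -> `|x - r| <= M * s -> ball (r, t) rho (x, t - s).
  move=> s0 sh xr; split; rewrite -ball_normE/=.
    rewrite distrC (le_lt_trans xr)// (le_lt_trans _ hrho)// mulrDr mulr1.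
    by rewrite mulrC ler_wpDr ?(ltW h0)// ler_wpM2r.
  rewrite subKr ger0_norm// (le_lt_trans sh)// (le_lt_trans _ hrho)//.
  by rewrite mulrDr mulr1 ler_wpDl.
have th0 : 0 <= t - h by rewrite subr_ge0 ltW.
have dh0 : 0 < d * h by rewrite mulr_gt0.
(* The tolerance [d * h] is the gain in [phi] that [Q] records at time [h], which makes the final
   inequalities contradictory. *)
have [l [c [tl cl ce]]] := schedule_value_adherent r (ltW t0) dh0.
pose Q x s := [/\ 0 <= s, `|x - r| <= M * s & phi (r, t) + d * s <= phi (x, t - s)].
have [||||//|x [_ xr phix] Vx] := @cost_le_split Q c (t - h) h th0 _ l r 0.
- move=> u x s k Uu k0 skh [s0 xr phix].
  have dist y : 0 <= y -> `|Phi u x y - r| <= M * (s + y).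
    move=> y0; rewrite -(subrKA x) (le_trans (ler_normD _ _))//.
    by rewrite mulrDr addrC lerD// flow_dist.
  split; [exact: addr_ge0|exact: dist|].
  rewrite mulrDr addrA; apply: le_trans (lerD phix (lexx _)) _.
  pose j y := phi (Phi u x y, t - s - y) - d * y.
  suff : j 0 <= j k.
    by rewrite /j mulr0 !subr0 Phi0// opprD addrA -lerBrDr.
  have pt_ok y : 0 <= y <= k -> [/\ 0 < t - s - y,
      d <= dotp (grad_r phi (Phi u x y, t - s - y)) (f (Phi u x y) u) -
        partial_t phi (Phi u x y, t - s - y)
      & differentiable phi (Phi u x y, t - s - y)].
    move=> /andP[y0 yk].
    have sy0 : 0 <= s + y by rewrite addr_ge0.
    have syh : s + y <= h by rewrite (le_trans _ skh)// lerD2l.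
    have := Hrho _ (near_pt _ _ sy0 syh (dist y y0)).
    rewrite opprD addrA /= => -[a /(_ u Uu) b _]; split=> //.
    by have [] := C1 (Phi u x y, t - s - y) a.
  apply: dini_nondecreasing => //.
  + move=> y yk e e0; have [_ _ dphi] := pt_ok y yk.
    have : {for y, continuous j}.
      apply: cvgB; last exact: mulrl_continuous.
      apply: (@continuous_comp _ _ _ (fun y => (Phi u x y, t - s - y)) phi).
        apply: (@lipschitz_bound_continuous _ _ _ _ (M + 1)) => a b.
        rewrite prod_normE/= ge_max; apply/andP; split.
          have [PhiM _] := PhiF x Uu; rewrite (le_trans (PhiM a b))//.
          by rewrite ler_wpM2r// lerDl.
        rewrite (_ : _ - _ = a - b); last by ring.
        by rewrite distrC ler_peMl// lerDr.
      exact: differentiable_continuous.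
    move=> /cvgrPdist_lt /(_ _ e0) /nbhs_ballP[a /= a0 Ha].
    exists a => // y' _ yy'; rewrite distrC; apply: Ha.
    by rewrite -ball_normE/= distrC.
  + move=> e e0 y y0 yk.
    have [_ Hdy dphi] := pt_ok y (introT andP (conj y0 (ltW yk))).
    have quad a : 0 <= a -> `|Phi u x (y + a) - Phi u x y - a *: f (Phi u x y) u|
        <= L * M * a ^+ 2.
      move=> a0; have [_ /(_ y (y + a) y0)] := PhiF x Uu.
      by rewrite lerDl (_ : y + a - y = a); [apply|ring].
    have [a a0 Ha] := chain_flow dphi quad e0.
    exists a => // b b0 ba _; have := Ha b b0 ba.
    rewrite ler_norml => /andP[+ _].
    have : b * d <= b * (dotp (grad_r phi (Phi u x y, t - s - y)) (f (Phi u x y) u) -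
        partial_t phi (Phi u x y, t - s - y)) by rewrite ler_wpM2l ?(ltW b0).
    rewrite /j (_ : t - s - (y + b) = t - s - y - b); last by ring.
    rewrite (mulrDr d) (mulrC d b); lra.
- exact: ltW.
- by split => //; rewrite ?mulr0 ?subrr ?normr0// subr0 addr0.
- by rewrite subr0 subrK.
have /= [_ _] := Hrho _ (near_pt x h (ltW h0) (lexx h) xr).
by lra.
Qed.

End schedules.

(** * Comparison of viscosity solutions *)

Section smooth_tests.
Context (R : realType) (n : nat).
Implicit Types (phi psi : 'rV[R]_n * R -> R) (dphi dpsi : 'rV[R]_n * R -> 'rV[R]_n * R -> R).

(** The derivative is carried along explicitly, so that gradients of composite test functions are
    obtained by evaluating [dphi] on basis vectors. *)
Definition has_C1 phi dphi : Prop :=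
  (forall p, differentiable phi p) /\
  (forall v, (forall p, 'D_v phi p = dphi p v) /\ continuous (dphi ^~ v)).

Lemma has_C1_on phi dphi A : has_C1 phi dphi -> C1_on A phi.
Proof.
move=> [d1 d2] p _; split=> // v; have [dE cd] := d2 v.
have -> : 'D_v phi = dphi ^~ v by apply/funext => x; exact: dE.
exact: cd.
Qed.

Lemma has_C1_partial_t phi dphi p : has_C1 phi dphi ->
  partial_t phi p = dphi p (0, 1).
Proof. by move=> [_ /(_ (0, 1))[<- _]]; rewrite derive_slice_time. Qed.

Lemma has_C1_grad_r phi dphi p i : has_C1 phi dphi ->
  grad_r phi p 0 i = dphi p (delta_mx 0 i, 0).
Proof. by move=> [_ /(_ (delta_mx 0 i, 0))[<- _]]; rewrite derive_slice_state mxE. Qed.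

Lemma has_C1_continuous phi dphi : has_C1 phi dphi -> continuous phi.
Proof. by move=> [d _] p; exact: differentiable_continuous. Qed.

Lemma has_C1_eq phi psi dphi dpsi : has_C1 phi dphi -> phi =1 psi ->
  dphi =2 dpsi -> has_C1 psi dpsi.
Proof.
move=> C1 /funext <- E; rewrite (_ : dpsi = dphi)//.
by apply/funext => p; apply/funext => v; rewrite E.
Qed.

Lemma has_C1_cst c : has_C1 (fun=> c) (fun _ _ => 0).
Proof.
split=> [p|v]; first exact: differentiable_cst.
split=> [p|]; last exact: cst_continuous.
exact: (derive_cst c).
Qed.

Lemma has_C1_add phi psi dphi dpsi : has_C1 phi dphi -> has_C1 psi dpsi ->
  has_C1 (fun p => phi p + psi p) (fun p v => dphi p v + dpsi p v).
Proof.
move=> [d1 e1] [d2 e2]; split=> [p|v]; first exact: differentiableD.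
have [E1 c1] := e1 v; have [E2 c2] := e2 v; split=> [p|p].
  rewrite -[fun _ => _]/(phi + psi) deriveD ?E1 ?E2//; exact: diff_derivable.
by apply: cvgD; [exact: c1|exact: c2].
Qed.

Lemma has_C1_mul phi psi dphi dpsi : has_C1 phi dphi -> has_C1 psi dpsi ->
  has_C1 (fun p => phi p * psi p) (fun p v => phi p * dpsi p v + psi p * dphi p v).
Proof.
move=> C1 C2; have [d1 e1] := C1; have [d2 e2] := C2.
split=> [p|v]; first exact: differentiableM.
have [E1 c1] := e1 v; have [E2 c2] := e2 v; split=> [p|p].
  rewrite -[fun _ => _]/(phi * psi) deriveM ?E1 ?E2//; exact: diff_derivable.
apply: cvgD; apply: cvgM.
- exact: (has_C1_continuous C1).
- exact: c2.
- exact: (has_C1_continuous C2).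
- exact: c1.
Qed.

Lemma has_C1_linear (F : {linear ('rV[R]_n * R)%type -> R}) : continuous F ->
  has_C1 F (fun _ v => F v).
Proof.
move=> cF; split=> [p|v]; first exact: linear_differentiable.
split=> [p|]; last exact: cst_continuous.
by rewrite deriveE ?diff_lin//; exact: linear_differentiable.
Qed.

Lemma has_C1_coord i : has_C1 (fun p => p.1 0 i) (fun _ v => v.1 0 i).
Proof.
have lin : linear (fun p : 'rV[R]_n * R => p.1 0 i : R).
  by move=> a x y /=; rewrite !mxE.
pose F : {linear ('rV[R]_n * R)%type -> R} := HB.pack (fun p : 'rV[R]_n * R => p.1 0 i : R)
  (GRing.isLinear.Build _ _ _ _ _ lin).
apply: (@has_C1_linear F); apply: (@lipschitz_bound_continuous _ _ _ _ 1) => x y /=.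
rewrite mul1r -[_ - _](_ : (y - x).1 0 i = _); last by rewrite !mxE.
by rewrite (le_trans (rV_coord_le _ _))// [leRHS]prod_normE/= le_max lexx.
Qed.

Lemma has_C1_time : has_C1 (fun p => p.2) (fun _ v => v.2).
Proof.
have lin : linear (fun p : 'rV[R]_n * R => p.2 : R) by [].
pose F : {linear ('rV[R]_n * R)%type -> R} := HB.pack (fun p : 'rV[R]_n * R => p.2 : R)
  (GRing.isLinear.Build _ _ _ _ _ lin).
apply: (@has_C1_linear F); apply: (@lipschitz_bound_continuous _ _ _ _ 1) => x y /=.
by rewrite mul1r [leRHS]prod_normE/= le_max lexx orbT.
Qed.

Lemma has_C1_expR phi dphi : has_C1 phi dphi ->
  has_C1 (fun p => expR (phi p)) (fun p v => expR (phi p) * dphi p v).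
Proof.
move=> C1; have [d1 e1] := C1.
have dexp (y : R) : differentiable (expR : R -> R) y.
  by apply/derivable1_diffP; exact: derivable_expR.
have dcomp p : differentiable (expR \o phi) p by apply: differentiable_comp.
split=> [p|v]; first exact: dcomp.
have [E1 c1] := e1 v; split=> [p|p].
  have Dp : 'd phi p v = dphi p v by rewrite -deriveE// E1.
  rewrite -[fun _ => _]/(expR \o phi) deriveE// diff_comp//= Dp.
  rewrite deriv1E; last exact: derivable_expR.
  by rewrite /= derive1E derive_val mulrC.
apply: cvgM; last exact: c1.
apply: continuous_comp; first exact: (has_C1_continuous C1).
exact: continuous_expR.
Qed.

Lemma has_C1_sum m (phi : 'I_m -> 'rV[R]_n * R -> R)
    (dphi : 'I_m -> 'rV[R]_n * R -> 'rV[R]_n * R -> R) :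
  (forall i, has_C1 (phi i) (dphi i)) ->
  has_C1 (fun p => \sum_i phi i p) (fun p v => \sum_i dphi i p v).
Proof.
elim: m phi dphi => [|m IH] phi dphi C1.
  by apply: (has_C1_eq (has_C1_cst 0)) => [p|p v]; rewrite big_ord0.
apply: (has_C1_eq (has_C1_add (C1 ord0) (IH _ _ (fun i => C1 (lift ord0 i))))).
  by move=> p; rewrite big_ord_recl.
by move=> p v; rewrite big_ord_recl.
Qed.

Lemma has_C1_exp phi dphi k : has_C1 phi dphi ->
  has_C1 (fun p => phi p ^+ k) (fun p v => k%:R * phi p ^+ k.-1 * dphi p v).
Proof.
move=> C1; elim: k => [|k IH].
  by apply: (has_C1_eq (has_C1_cst 1)) => // p v; rewrite !mul0r.
apply: (has_C1_eq (has_C1_mul C1 IH)) => [p|p v]; first by rewrite exprS.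
by case: k {IH} => [|k] /=; rewrite ?expr0 ?exprS; ring.
Qed.

End smooth_tests.

(** Heine-Cantor relative to [D], since solutions are continuous only within nonnegative times. *)
Lemma compact_uniform_continuous (R : realType) (V : normedModType R)
    (D : set V) (w : V -> R) (e : R) :
  compact D -> {within D, continuous w} -> 0 < e ->
  exists2 d : R, 0 < d &
    forall x y, D x -> D y -> `|x - y| < d -> `|w x - w y| < e.
Proof.
move=> /compact_near_coveringP/near_covering_withinP cD /subspace_continuousP cw e0.
pose P (d : R) x := forall y, D y -> `|x - y| < d -> `|w x - w y| < e.
suff : \forall d \near 0^'+, D `<=` P d.
  move=> H; have Hd : \forall d \near 0^'+, (0 : R) < d by exact: nbhs_right_gt.
  have [d [d0 dP]] := filter_ex (filterI Hd H).
  by exists d => // x y Dx Dy; exact: dP.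
apply: cD => x Dx.
have e20 : 0 < e / 2 by rewrite divr_gt0.
have /cvgrPdist_lt/(_ _ e20) := cw x Dx.
move=> /nbhs_ballP[r /= r0 Hr].
have r20 : 0 < r / 2 by rewrite divr_gt0.
exists (ball x (r / 2), [set d | d < r / 2]); first split => /=.
- exact: nbhsx_ballx.
- exact: nbhs_right_lt.
move=> [z d] /= [xz dr] Dz y Dy zy.
rewrite -ball_normE/= in xz.
have hz : `|w x - w z| < e / 2.
  by apply: Hr => //; rewrite -ball_normE/= (lt_trans xz)// ltr_pdivrMr// ltr_pMr// ltr1n.
have hy : `|w x - w y| < e / 2.
  apply: Hr => //; rewrite -ball_normE/= -(subrKA z) (le_lt_trans (ler_normD _ _))//.
  by rewrite [r]splitr ltrD// (lt_trans zy).
rewrite -(subrKA (w x)) (le_lt_trans (ler_normD _ _))// [e]splitr ltrD//.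
by rewrite distrC.
Qed.

(** * Quadratic penalty, barrier and compact box *)

Section doubling_tests.
Context (R : realType) (n : nat).
Implicit Types (a : 'rV[R]_n) (p q b : 'rV[R]_n * R).

(** The Euclidean square replaces the maximum norm, which is not smooth; [sqdist_norm] compares the
    two. *)
Definition sqdist a (x : 'rV[R]_n) : R := \sum_i (x 0 i - a 0 i) ^+ 2.

Lemma sqdist_ge0 a x : 0 <= sqdist a x.
Proof. by apply: sumr_ge0 => i _; exact: sqr_ge0. Qed.

Lemma sqdist_norm a x : `|x - a| ^+ 2 <= sqdist a x.
Proof.
suff : `|x - a| <= Num.sqrt (sqdist a x).
  by rewrite -(@ler_pXn2r _ 2) ?nnegrE ?sqrtr_ge0// sqr_sqrtr ?sqdist_ge0.
apply: rV_norm_le => [|i]; first exact: sqrtr_ge0.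
rewrite !mxE -sqrtr_sqr ler_wsqrtr// /sqdist (bigD1 i)//= lerDl.
by apply: sumr_ge0 => j _; exact: sqr_ge0.
Qed.

Lemma has_C1_sqdist a : has_C1 (fun p : 'rV[R]_n * R => sqdist a p.1)
  (fun p v => \sum_i 2 * (p.1 0 i - a 0 i) * v.1 0 i).
Proof.
apply: has_C1_sum => i.
have C := has_C1_add (has_C1_coord R i) (has_C1_cst n (- a 0 i)).
apply: (has_C1_eq (has_C1_exp 2 C)) => // p v.
by rewrite addr0 expr1.
Qed.

Definition penalty c b p : R := c * (sqdist b.1 p.1 + (p.2 - b.2) ^+ 2).

Lemma has_C1_penalty c b : has_C1 (penalty c b) (fun p v =>
  c * (\sum_i 2 * (p.1 0 i - b.1 0 i) * v.1 0 i + 2 * (p.2 - b.2) * v.2)).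
Proof.
have C := has_C1_add (has_C1_time R n) (has_C1_cst n (- b.2)).
have C' := has_C1_add (has_C1_sqdist b.1) (has_C1_exp 2 C).
apply: (has_C1_eq (has_C1_mul (has_C1_cst n c) C')) => // p v.
by rewrite mulr0 !addr0 expr1.
Qed.

Lemma penalty_ge0 c b p : 0 <= c -> 0 <= penalty c b p.
Proof. by move=> c0; rewrite mulr_ge0// addr_ge0 ?sqdist_ge0// sqr_ge0. Qed.

Lemma penaltyxx c p : penalty c p p = 0.
Proof.
rewrite /penalty subrr expr0n/= addr0 /sqdist big1 ?mulr0// => i _.
by rewrite subrr expr0n.
Qed.

Lemma penaltyC c b p : penalty c b p = penalty c p b.
Proof.
rewrite /penalty -(sqrrN (p.2 - b.2)) opprB; congr (_ * (_ + _)).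
by apply: eq_bigr => i _; rewrite -sqrrN opprB.
Qed.

Lemma penalty_norm c b p : 0 <= c -> c * `|p - b| ^+ 2 <= penalty c b p.
Proof.
move=> c0; rewrite ler_wpM2l// prod_normE/= /Num.max; case: ifP => _.
  by rewrite real_normK ?num_real// lerDr sqdist_ge0.
by rewrite (le_trans (sqdist_norm b.1 p.1))// lerDl sqr_ge0.
Qed.

Lemma sum_delta (F : 'I_n -> R) i :
  \sum_j F j * (delta_mx 0 i : 'rV[R]_n) 0 j = F i.
Proof.
rewrite (bigD1 i)//= mxE !eqxx mulr1 big1 ?addr0// => j ji.
by rewrite mxE (negbTE ji) andbF mulr0.
Qed.

Lemma partial_t_penalty c b p : partial_t (penalty c b) p = 2 * c * (p.2 - b.2).
Proof.
rewrite (has_C1_partial_t p (has_C1_penalty c b)) /= big1 ?add0r; first by ring.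
by move=> i _; rewrite mxE mulr0.
Qed.

Lemma grad_r_penalty c b p i :
  grad_r (penalty c b) p 0 i = 2 * c * (p.1 0 i - b.1 0 i).
Proof.
rewrite (has_C1_grad_r p i (has_C1_penalty c b)) /= mulr0 addr0.
by rewrite (sum_delta (fun j => 2 * (p.1 0 j - b.1 0 j))); ring.
Qed.

Lemma penalty_continuous c :
  continuous (fun X : ('rV[R]_n * R) * ('rV[R]_n * R) => penalty c X.2 X.1).
Proof.
have sumc m (F : 'I_m -> ('rV[R]_n * R) * ('rV[R]_n * R) -> R) :
    (forall i, continuous (F i)) -> continuous (fun X => \sum_i F i X).
  elim: m F => [|m IH] F cF X.
    rewrite (_ : (fun _ => _) = cst 0); first exact: cst_continuous.
    by apply/funext => Y; rewrite big_ord0.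
  rewrite (_ : (fun _ => _) = fun Y => F ord0 Y + \sum_i F (lift ord0 i) Y).
    by apply: cvgD; [exact: cF|apply: (IH (fun i => F (lift ord0 i))) => i].
  by apply/funext => Y; rewrite big_ord_recl.
have c1 : continuous (fun X : ('rV[R]_n * R) * ('rV[R]_n * R) => X.1).
  by move=> X; exact: cvg_fst.
have c2 : continuous (fun X : ('rV[R]_n * R) * ('rV[R]_n * R) => X.2).
  by move=> X; exact: cvg_snd.
have cc i := has_C1_continuous (has_C1_coord R i : @has_C1 R n _ _).
have ct := has_C1_continuous (has_C1_time R n).
have sq (F G : ('rV[R]_n * R) * ('rV[R]_n * R) -> R) :
    continuous F -> continuous G -> continuous (fun X => (F X - G X) ^+ 2).
  move=> cF cG X.
  by apply: cvgM; apply: cvgB; (exact: cF || exact: cG).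
move=> X; apply: cvgM; first exact: cvg_cst.
apply: cvgD; [apply: sumc => i|]; apply: sq => Y.
- by apply: (@continuous_comp _ _ _ fst (fun p => p.1 0 i)); [exact: c1|exact: cc].
- by apply: (@continuous_comp _ _ _ snd (fun p => p.1 0 i)); [exact: c2|exact: cc].
- by apply: (@continuous_comp _ _ _ fst (fun p => p.2)); [exact: c1|exact: ct].
- by apply: (@continuous_comp _ _ _ snd (fun p => p.2)); [exact: c2|exact: ct].
Qed.

Definition barrier a t0 m p : R := (1 + sqdist a p.1) * expR (m * (p.2 - t0)).

Lemma has_C1_barrier a t0 m : has_C1 (barrier a t0 m) (fun p v =>
  expR (m * (p.2 - t0)) *
    ((1 + sqdist a p.1) * (m * v.2) + \sum_i 2 * (p.1 0 i - a 0 i) * v.1 0 i)).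
Proof.
have C := has_C1_add (has_C1_time R n) (has_C1_cst n (- t0)).
have C2 := has_C1_expR (has_C1_mul (has_C1_cst n m) C).
have C3 := has_C1_add (has_C1_cst n 1) (has_C1_sqdist a).
apply: (has_C1_eq (has_C1_mul C3 C2)) => // p v.
by rewrite mulr0 !addr0 add0r; ring.
Qed.

Lemma barrier_ge0 a t0 m p : 0 <= barrier a t0 m p.
Proof. by rewrite mulr_ge0 ?expR_ge0// addr_ge0 ?sqdist_ge0. Qed.

Lemma barrier_center a t0 m : barrier a t0 m (a, t0) = 1.
Proof.
rewrite /barrier/= subrr mulr0 expR0 mulr1 /sqdist big1 ?addr0// => i _.
by rewrite subrr expr0n.
Qed.

(** The region below level 2 is bounded: [expR y >= 1 + y] limits the time, and nonnegative times
    keep the exponential above [expR (- (m * t0))], which limits the distance. *)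
Lemma barrier_lt2 a t0 m p : 0 < m -> 0 <= p.2 -> barrier a t0 m p < 2 ->
  `|p.1 - a| <= 1 + 2 * expR (m * t0) /\ p.2 <= t0 + m^-1.
Proof.
move=> m0 p0 z2; have E0 := expR_gt0 (m * (p.2 - t0)).
have Q0 := sqdist_ge0 a p.1.
split; last first.
  have : expR (m * (p.2 - t0)) < 2.
    by apply: le_lt_trans z2; rewrite ler_peMl ?expR_ge0// lerDl.
  move=> /(le_lt_trans (expR_ge1Dx _)) H.
  rewrite -lerBlDl -[m^-1]mulr1 ler_pdivlMl//.
  lra.
have E1 : expR (- (m * t0)) <= expR (m * (p.2 - t0)).
  by rewrite ler_expR mulrBr lerDr mulr_ge0// ltW.
have QE : sqdist a p.1 <= 2 * expR (m * t0).
  rewrite -ler_pdivrMr ?expR_gt0// -expRN.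
  apply: le_trans (ltW z2); rewrite /barrier mulrDl mul1r.
  by rewrite ler_wpDl ?expR_ge0// ler_wpM2l.
have := sqdist_norm a p.1; have := normr_ge0 (p.1 - a).
move=> x0 xQ; have := sqr_ge0 (`|p.1 - a| - 1); rewrite sqrrB1.
by have := expR_gt0 (m * t0); lra.
Qed.

(** From [2 * |y| <= 1 + y ^+ 2] in each coordinate, the spatial gradient is at most
    [n * (1 + sqdist)] times the exponential, while the time derivative has the factor [m]. *)
Lemma barrier_drift a t0 m M p : 0 <= M -> n%:R * M <= m -> (0 < n)%N ->
  norm1 (grad_r (barrier a t0 m) p) * M <= partial_t (barrier a t0 m) p.
Proof.
move=> M0 nM n0; rewrite (has_C1_partial_t p (has_C1_barrier a t0 m)) /=.
rewrite mulr1 big1 ?addr0; last by move=> i _; rewrite mxE mulr0.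
have -> : norm1 (grad_r (barrier a t0 m) p) =
    expR (m * (p.2 - t0)) * \sum_i `|2 * (p.1 0 i - a 0 i)|.
  rewrite /norm1 mulr_sumr; apply: eq_bigr => i _.
  rewrite (has_C1_grad_r p i (has_C1_barrier a t0 m)) /= !mulr0 add0r normrM.
  rewrite gtr0_norm ?expR_gt0//; congr (_ * `|_|).
  exact: (sum_delta (fun j => 2 * (p.1 0 j - a 0 j))).
rewrite -mulrA ler_wpM2l ?expR_ge0//.
have n1 : 1 <= n%:R :> R by rewrite ler1n.
apply: (@le_trans _ _ ((n%:R + sqdist a p.1) * M)).
  have nE : n%:R = \sum_(i < n) 1 :> R by rewrite sumr_const card_ord.
  rewrite ler_wpM2r// nE /sqdist -big_split/=.
  apply: ler_sum => i _; rewrite normrM ger0_norm//.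
  have := sqr_ge0 (`|p.1 0 i - a 0 i| - 1); rewrite sqrrB1 real_normK ?num_real//; lra.
apply: (@le_trans _ _ ((1 + sqdist a p.1) * (n%:R * M))); last first.
  by rewrite ler_wpM2l// addr_ge0// sqdist_ge0.
rewrite mulrA ler_wpM2r// mulrDl mul1r lerD2l.
by rewrite ler_peMr// sqdist_ge0.
Qed.

Definition box a (rho T : R) : set ('rV[R]_n * R)%type :=
  [set v : 'rV[R]_n | forall i, `[a 0 i - rho, a 0 i + rho]%classic (v 0 i)]
  `*` `[0, T]%classic.

Lemma box_compact a rho T : compact (box a rho T).
Proof.
apply: compact_setX; last exact: segment_compact.
by apply: (@rV_compact _ _ (fun i => `[a 0 i - rho, a 0 i + rho]%classic)) => i;
  exact: segment_compact.
Qed.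

Lemma boxP a rho T p : `|p.1 - a| <= rho -> 0 <= p.2 <= T -> box a rho T p.
Proof.
move=> pa p2; split=> [i|] /=; last by rewrite in_itv.
have := le_trans (rV_coord_le (p.1 - a) i) pa.
by rewrite !mxE in_itv/= ler_distl.
Qed.

Lemma box_nbhs a rho T p : `|p.1 - a| < rho -> 0 < p.2 -> p.2 < T ->
  \forall q \near p, box a rho T q.
Proof.
move=> pa p0 pT.
pose d := Num.min (rho - `|p.1 - a|) (Num.min p.2 (T - p.2)).
have d0 : 0 < d by rewrite !lt_min !subr_gt0 pa p0.
apply: filterS (nbhsx_ballx p _ d0) => q [].
rewrite -!ball_normE/= !lt_min => /andP[h1 _] /and3P[_ h2 h3].
apply: boxP.
  rewrite -(subrKA p.1) (le_trans (ler_normD _ _))// distrC.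
  by rewrite -lerBrDr ltW.
by move: h2 h3; rewrite !ltr_norml; lra.
Qed.

End doubling_tests.

Lemma within_comp (R : realType) (V W : topologicalType) (A : set V) (B : set W)
    (h : W -> V) (w : V -> R) :
  {within A, continuous w} -> continuous h -> (forall x, B x -> A (h x)) ->
  {within B, continuous (w \o h)}.
Proof.
move=> /subspace_continuousP cw ch BA; apply/subspace_continuousP => x Bx.
have hx : h y @[y --> within B (nbhs x)] --> within A (nbhs (h x)).
  move=> P /= AP; have := ch x _ AP; rewrite /= !nbhs_simpl/=.
  by apply: filterS => y Py By; exact: Py (BA _ By).
by move=> Q /(cw _ (BA _ Bx)) /hx.
Qed.

Lemma geometric_lt (R : realType) (S s : R) : 0 < s -> exists N, S < s * 2 ^+ N.
Proof.
move=> s0; apply: contrapT => /forallNP H.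
have : s <= 0.
  apply: (@le_of_geometric _ _ _ S) => n; rewrite add0r exprVn.
  by rewrite ler_pdivlMr ?exprn_gt0// leNgt; apply/negP.
by rewrite leNgt s0.
Qed.

(* If [w1 > w2] somewhere, maximize [w1 x - w2 y - c |x - y|^2 - barrier] over a
   compact box: the barrier, a supersolution of the linearized equation by
   finite propagation speed, makes growth conditions at infinity unnecessary. *)
Lemma viscosity_comparison (R : realType) (H : state R -> state R -> R)
    (g : state R -> R) (w1 w2 : state R * R -> R) (L M K : R) :
  0 <= L -> 0 <= M -> 0 <= K ->
  (forall r r' q z, H r' q - H r (q + z) <= norm1 q * (L * `|r' - r|) + norm1 z * M) ->
  (forall x y, `|g x - g y| <= K * `|x - y|) ->
  {within [set p | 0 <= p.2], continuous w1} ->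
  {within [set p | 0 <= p.2], continuous w2} ->
  (forall r, w1 (r, 0) <= w2 (r, 0)) ->
  (forall phi p, C1_on [set q : state R * R | 0 < q.2] phi -> 0 < p.2 ->
     local_max (fun x => w1 x - phi x) p -> qvi_operator H g w1 phi p <= 0) ->
  (forall phi p, C1_on [set q : state R * R | 0 < q.2] phi -> 0 < p.2 ->
     local_min (fun x => w2 x - phi x) p -> 0 <= qvi_operator H g w2 phi p) ->
  forall r t, 0 <= t -> w1 (r, t) <= w2 (r, t).
Proof.
move=> L0 M0 K0 HH gK cw1 cw2 w120 sub1 sup2 r0 t0; rewrite le_eqVlt => /orP[/eqP <-//|t00].
rewrite leNgt; apply/negP => w21.
(* The gap is split in three: at [(r0, t0)] the barrier takes one [s], the term [lam * t0] another,
   and [Psi] keeps the last. *)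
pose s : R := (w1 (r0, t0) - w2 (r0, t0)) / 3.
have s0 : 0 < s by rewrite divr_gt0// subr_gt0.
pose m : R := 7 * M + 1.
have m0 : 0 < m by rewrite ltr_wpDl// mulr_ge0.
pose lam : R := s / t0.
have lam0 : 0 < lam by rewrite divr_gt0.
pose z := barrier r0 t0 m.
(* The box exceeds the region of [barrier_lt2] by 1 in time and in space, so that [x], and [y] at
   distance less than 1 from it, have neighbourhoods in the box. *)
pose T : R := t0 + m^-1 + 1.
pose rho : R := 1 + 2 * expR (m * t0) + 1.
pose D := box r0 rho T.
have cD : compact D by exact: box_compact.
have m10 : 0 < m^-1 by rewrite invr_gt0.
have Dx0 : D (r0, t0).
  apply: boxP => /=.
    by rewrite subrr normr0 /rho; have := expR_gt0 (m * t0); lra.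
  by rewrite /T; lra.
have D0 : D `<=` [set p | 0 <= p.2].
  by move=> p [_] /=; rewrite in_itv/= => /andP[].
have cw1D : {within D, continuous w1} by exact: continuous_subspaceW cw1.
have cw2D : {within D, continuous w2} by exact: continuous_subspaceW cw2.
have Dne : D !=set0 by exists (r0, t0).
have [xM _ HxM] := compact_EVT_max Dne cD cw1D.
have [xm _ Hxm] := compact_EVT_min Dne cD cw2D.
pose S : R := w1 xM - w2 xm.
have HS x y : D x -> D y -> w1 x - w2 y <= S.
  by move=> Dx Dy; rewrite lerB ?HxM ?Hxm ?inE.
have S0 : 0 < S by apply: lt_le_trans (HS _ _ Dx0 Dx0); rewrite subr_gt0.
(* With this exponent, a point where the barrier is at least 2 loses more than [S] and cannot be
   maximal. *)
have [N HN] := geometric_lt S s0.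
(* The factor 14 is the dimension 7 times the 2 from differentiating squares; this choice lets [lam]
   beat the error of the Hamiltonian in [r]. *)
pose mu : R := Num.min s (lam / (14 * L + 1)).
have L1 : 0 < 14 * L + 1 by rewrite ltr_wpDl// mulr_ge0.
have mu0 : 0 < mu by rewrite lt_min s0 divr_gt0.
have [d1 d10 Hd1] := compact_uniform_continuous cD cw1D mu0.
have [d2 d20 Hd2] := compact_uniform_continuous cD cw2D mu0.
pose d : R := Num.min (Num.min d1 d2) (Num.min 1 (s / (K + 1))).
have K1 : 0 < K + 1 by rewrite ltr_wpDl.
have d0 : 0 < d by rewrite !lt_min d10 d20 ltr01 divr_gt0.
(* At the maximum the penalty is at most [S], so this [c] forces [|x - y| < d]. *)
pose c : R := (S + 1) / d ^+ 2.
have c0 : 0 < c by rewrite divr_gt0 ?exprn_gt0// addr_gt0.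
pose Psi (X : (state R * R) * (state R * R)) : R :=
  w1 X.1 - w2 X.2 - penalty c X.2 X.1 - s * z X.1 ^+ N - lam * X.1.2.
have cPsi : {within D `*` D, continuous Psi}.
  have cw1' : {within D `*` D, continuous (w1 \o fst)}.
    by apply: (within_comp cw1D) => [|X []//] X; exact: cvg_fst.
  have cw2' : {within D `*` D, continuous (w2 \o snd)}.
    by apply: (within_comp cw2D) => [|X []//] X; exact: cvg_snd.
  move=> X; apply: cvgB; last first.
    apply: cvgM; first exact: cvg_cst.
    apply: (@continuous_subspaceT _ _ _ (fun X => X.1.2)) => Y.
    apply: (@continuous_comp _ _ _ fst (fun p => p.2)); first exact: cvg_fst.
    exact: cvg_snd.
  apply: cvgB; last first.
    apply: (@continuous_subspaceT _ _ _ (fun X => s * z X.1 ^+ N)) => Y.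
    apply: (@continuous_comp _ _ _ fst (fun p => s * z p ^+ N)); first exact: cvg_fst.
    exact: (has_C1_continuous (has_C1_mul (has_C1_cst 7 s) (has_C1_exp N (has_C1_barrier r0 t0 m)))).
  apply: cvgB; last first.
    apply: (@continuous_subspaceT _ _ _ (fun X => penalty c X.2 X.1)).
    exact: penalty_continuous.
  by apply: cvgB; [exact: cw1'|exact: cw2'].
have [|[x y] /set_mem [/= Dx Dy] Hmax] := compact_EVT_max _ (compact_setX cD cD) cPsi.
  by exists ((r0, t0), (r0, t0)).
have {}Hmax x' y' : D x' -> D y' -> Psi (x', y') <= Psi (x, y).
  by move=> Dx' Dy'; apply: Hmax; rewrite inE.
have Psi0 : Psi ((r0, t0), (r0, t0)) = s.
  by rewrite /Psi/= penaltyxx /z barrier_center expr1n /lam /s; field; rewrite gt_eqF.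
have Psixy : s <= Psi (x, y) by rewrite -Psi0; exact: Hmax.
have x20 : 0 <= x.2 by exact: D0.
have y20 : 0 <= y.2 by exact: D0.
have pen0 : 0 <= penalty c y x by rewrite penalty_ge0 ?(ltW c0).
have z0 : 0 <= s * z x ^+ N by rewrite mulr_ge0 ?exprn_ge0 ?barrier_ge0 ?(ltW s0).
have lx0 : 0 <= lam * x.2 by rewrite mulr_ge0 ?(ltW lam0).
have Sxy := HS _ _ Dx Dy.
rewrite /Psi/= in Psixy.
have w12s : s <= w1 x - w2 y by clear -Psixy pen0 z0 lx0; lra.
have penS : penalty c y x <= S by clear -Psixy Sxy s0 z0 lx0; lra.
have xyd : `|x - y| < d.
  rewrite -(@ltr_pXn2r _ 2) ?nnegrE ?(ltW d0)// -(ltr_pM2l c0).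
  rewrite (le_lt_trans (penalty_norm _ _ (ltW c0)))// (le_lt_trans penS)//.
  by rewrite /c divfK ?gt_eqF ?exprn_gt0// ltrDl.
move: (xyd); rewrite /d !lt_min -andbA => /and4P[xyd1 xyd2 xy1 xyK].
(* Comparing with the diagonal point [(x, x)] bounds the penalty by the oscillation of [w2].
   Closeness of [x] and [y] alone would not suffice, because [c] is large. *)
have penmu : penalty c y x < mu.
  have := Hmax x x Dx Dx; rewrite /Psi/= penaltyxx => h.
  have := Hd2 _ _ Dx Dy xyd2; rewrite ltr_norml => /andP[_ h']; clear -h h'; lra.
have zx2 : z x < 2.
  rewrite ltNge; apply/negP => z2.
  have : s * 2 ^+ N <= s * z x ^+ N.
    by rewrite ler_wpM2l ?(ltW s0)// lerXn2r ?nnegrE// barrier_ge0.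
  by clear -Psixy Sxy s0 pen0 lx0 HN; lra.
have mus : mu <= s by rewrite ge_min lexx.
(* At time 0 the initial inequality and uniform continuity would give [w1 x - w2 y < mu <= s]. *)
have x2 : 0 < x.2.
  rewrite lt_neqAle x20 andbT; apply/eqP => xE.
  have xx : x = (x.1, 0) by rewrite xE; case: (x).
  have := Hd2 _ _ Dx Dy xyd2; rewrite ltr_norml => /andP[_ h'].
  by have := w120 x.1; rewrite -xx; clear -w12s h' mus; lra.
have y2 : 0 < y.2.
  rewrite lt_neqAle y20 andbT; apply/eqP => yE.
  have yy : y = (y.1, 0) by rewrite yE; case: (y).
  have := Hd1 _ _ Dx Dy xyd1; rewrite ltr_norml => /andP[_ h'].
  by have := w120 y.1; rewrite -yy; clear -w12s h' mus; lra.
have [xr xT] := barrier_lt2 m0 x20 zx2.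
have /andP[xy1r xy1t] : (`|x.1 - y.1| < 1) && (`|x.2 - y.2| < 1).
  by move: xy1; rewrite prod_normE/= gt_max.
have nx : \forall p \near x, D p.
  by apply: box_nbhs => //; rewrite /rho /T; clear -xr xT; lra.
have ny : \forall p \near y, D p.
  apply: box_nbhs => //.
    rewrite -(subrKA x.1) (le_lt_trans (ler_normD _ _))// distrC /rho addrC.
    by rewrite ler_ltD.
  by move: xy1t; rewrite ltr_norml /T; clear -xT; lra.
have Cz := has_C1_barrier r0 t0 m.
pose phi1 p := penalty c y p + (s * z p ^+ N + lam * p.2).
have C1 : has_C1 phi1 _ := has_C1_add (has_C1_penalty c y)
  (has_C1_add (has_C1_mul (has_C1_cst 7 s) (has_C1_exp N Cz))
    (has_C1_mul (has_C1_cst 7 lam) (has_C1_time R 7))).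
pose phi2 p := -1 * penalty c x p.
have C2 : has_C1 phi2 _ := has_C1_mul (has_C1_cst 7 (-1)) (has_C1_penalty c x).
have lmax : local_max (fun p => w1 p - phi1 p) x.
  by apply: filterS nx => p Dp; have := Hmax p y Dp Dy; rewrite /Psi/phi1/=; clear; lra.
have lmin : local_min (fun p => w2 p - phi2 p) y.
  apply: filterS ny => p Dp; have := Hmax x p Dx Dp.
  by rewrite /Psi/phi2/= (penaltyC c p) (penaltyC c y); clear; lra.
have := sup2 _ y (has_C1_on C2) y2 lmin.
rewrite /qvi_operator le_min subr_ge0 => /andP[gy Hy].
have := sub1 _ x (has_C1_on C1) x2 lmax.
have xy1d : `|x.1 - y.1| <= `|x - y| by rewrite [leRHS]prod_normE/= le_max lexx.
(* When the obstacle is active for [w1], the bounds [w1 x <= g x.1] and [g y.1 <= w2 y] contradict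
   the gap [s], since [g] is Lipschitz. *)
rewrite /qvi_operator ge_min => /orP[gx|Hx].
  have := le_trans (ler_norm _) (gK x.1 y.1).
  have : K * `|x.1 - y.1| < s.
    apply: (@le_lt_trans _ _ ((K + 1) * `|x - y|)).
      by rewrite ler_pM// lerDl.
    by rewrite mulrC -ltr_pdivlMr.
  by clear -w12s gx gy; lra.
pose A : R := s * (N%:R * z x ^+ N.-1).
have A0 : 0 <= A.
  by rewrite mulr_ge0 ?(ltW s0)// mulr_ge0// exprn_ge0// barrier_ge0.
pose q := grad_r phi2 y; pose Z := A *: grad_r z x.
have qE i : q 0 i = 2 * c * (x.1 0 i - y.1 0 i).
  rewrite /q (has_C1_grad_r y i C2) /= -(has_C1_grad_r y i (has_C1_penalty c x)).
  by rewrite grad_r_penalty; ring.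
have gradE : grad_r phi1 x = q + Z.
  apply/rowP => i; rewrite [RHS]mxE qE [Z 0 i]mxE (has_C1_grad_r x i C1).
  rewrite -(has_C1_grad_r x i (has_C1_penalty c y)) -(has_C1_grad_r x i Cz).
  by rewrite grad_r_penalty /A -/z /=; ring.
have pt1 : partial_t phi1 x = 2 * c * (x.2 - y.2) + (A * partial_t z x + lam).
  rewrite (has_C1_partial_t x C1) -(has_C1_partial_t x (has_C1_penalty c y)).
  by rewrite -(has_C1_partial_t x Cz) partial_t_penalty /A -/z /=; ring.
have pt2 : partial_t phi2 y = 2 * c * (x.2 - y.2).
  rewrite (has_C1_partial_t y C2) -(has_C1_partial_t y (has_C1_penalty c x)).
  by rewrite partial_t_penalty; ring.
have sum7 (b : R) : \sum_(i < 7) b = 7 * b by rewrite sumr_const card_ord mulr_natl.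
have c20 : 0 <= 2 * c by apply: mulr_ge0 => //; exact: ltW.
have n1q : norm1 q <= 7 * (2 * c * `|x.1 - y.1|).
  apply: (@le_trans _ _ (\sum_(i < 7) (2 * c * `|x.1 - y.1|))).
    apply: ler_sum => i _; rewrite qE normrM (ger0_norm c20) ler_wpM2l//.
    by have := rV_coord_le (x.1 - y.1) i; rewrite !mxE.
  by rewrite sum7.
have cpen : c * `|x.1 - y.1| ^+ 2 <= penalty c y x.
  rewrite (le_trans _ (penalty_norm _ _ (ltW c0)))// ler_wpM2l ?(ltW c0)//.
  by rewrite lerXn2r ?nnegrE.
have B1 : norm1 q * (L * `|y.1 - x.1|) <= 14 * L * penalty c y x.
  rewrite distrC (le_trans (ler_wpM2r _ n1q))//; first by rewrite mulr_ge0.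
  rewrite [leLHS](_ : _ = 14 * L * (c * `|x.1 - y.1| ^+ 2)); last by ring.
  by rewrite ler_wpM2l// mulr_ge0.
have B2 : norm1 Z * M <= A * partial_t z x.
  have -> : norm1 Z = A * norm1 (grad_r z x).
    by rewrite /norm1 mulr_sumr; apply: eq_bigr => i _; rewrite mxE normrM ger0_norm.
  rewrite -mulrA ler_wpM2l// barrier_drift// /m lerDl//.
have B3 : 14 * L * penalty c y x < lam.
  apply: (@le_lt_trans _ _ (14 * L * (lam / (14 * L + 1)))).
    rewrite ler_wpM2l ?mulr_ge0// (le_trans (ltW penmu))// ge_min lexx orbT//.
  rewrite mulrCA gtr_pMr// ltr_pdivrMr// mul1r ltrDl//.
(* Subtracting the two inequalities cancels the time derivatives of the penalty; the barrier absorbs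
   its own gradient term, and [lam] exceeds what remains. *)
have := HH x.1 y.1 q Z.
by move: Hx Hy; rewrite gradE pt1 pt2 -/q; clear -B1 B2 B3; lra.
Qed.

(** * Trajectories of measurable controls *)

Lemma is_derive_right (R : realType) (V : normedModType R) (x : R -> V) (s : R)
    (v : V) (e : R) : is_derive s 1 x v -> 0 < e ->
  exists2 d : R, 0 < d & forall k, 0 < k -> k < d ->
    `|x (s + k) - x s - k *: v| <= e * k.
Proof.
move=> [dx xE] e0; move: dx => /cvg_ex[l xl].
have lv : l = v by rewrite -xE; apply/esym/cvg_lim.
rewrite {}lv in xl.
have /cvgrPdist_le /(_ _ e0) := xl.
rewrite near_withinE => /nbhs_ballP[d /= d0 Hd]; exists d => // k k0 kd.
have := Hd k; rewrite -ball_normE/= sub0r normrN gtr0_norm// => /(_ kd).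
move=> /(_ (lt0r_neq0 k0)) H.
have -> : x (s + k) - x s - k *: v = - (k *: (v - k^-1 *: (x (k *: 1 + s) - x s))).
  rewrite scalerBr scalerA divff ?lt0r_neq0// scale1r opprB.
  by rewrite [k *: 1]mulr1 addrC [k + s]addrC addrC.
by rewrite normrN normrZ gtr0_norm// mulrC ler_wpM2r// ltW.
Qed.

(** The expansion is only forward. For [k < 0] it is started at [s + k], and the Lipschitz bounds on
    [F] and [y] move its slope to [s], whence the extra constant [L * M]; this needs room to the
    left of [s]. *)
Lemma flow_curve_is_derive (R : realType) n (F : 'rV[R]_n -> 'rV[R]_n)
    (L M C : R) (y : R -> 'rV[R]_n) (s : R) :
  0 <= L -> (forall u v, `|F u - F v| <= L * `|u - v|) ->
  flow_curve F M C y -> 0 < s -> is_derive s 1 y (F (y s)).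
Proof.
move=> L0 FL [yM yC] s0.
pose B := C + L * M.
have yB k : `|k| < s -> `|y (s + k) - y s - k *: F (y s)| <= `|B| * `|k| ^+ 2.
  move=> ks; apply: (@le_trans _ _ (B * `|k| ^+ 2)); last first.
    by rewrite ler_wpM2r ?sqr_ge0 ?ler_norm.
  have LM0 : 0 <= L * M.
    by rewrite mulr_ge0//; have := le_trans (normr_ge0 _) (yM 0 1); rewrite subr0 normr1 mulr1.
  have [k0|k0] := leP 0 k.
    have := yC s (s + k) (ltW s0); rewrite lerDl (_ : s + k - s = k); last by ring.
    move=> /(_ k0)/le_trans; apply; rewrite (ger0_norm k0) ler_wpM2r ?sqr_ge0// lerDl//.
  have sk : 0 <= s + k by move: ks; rewrite ltr_norml => /andP[? _]; lra.
  have := yC (s + k) s sk; rewrite gerDl (_ : s - (s + k) = - k); last by ring.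
  move=> /(_ (ltW k0)); rewrite sqrrN => h.
  have -> : y (s + k) - y s - k *: F (y s) =
      - (y s - y (s + k) - (- k) *: F (y (s + k))) + (- k) *: (F (y s) - F (y (s + k))).
    by apply/matrixP => i j; rewrite !mxE; ring.
  rewrite (le_trans (ler_normD _ _))// normrN mulrDl lerD//.
    by rewrite ltr0_norm// sqrrN.
  rewrite normrZ normrN expr2 mulrCA mulrA [_ * `|k|]mulrC ler_wpM2l//.
  rewrite (le_trans (FL _ _))// mulrCA ler_wpM2l// mulrC (le_trans (yM _ _))//.
  by rewrite (_ : s - (s + k) = - k) ?normrN//; ring.
have cvgy : h^-1 *: (y (h *: 1 + s) - y s) @[h --> (0 : R)^'] --> F (y s).
  apply/cvgrPdist_le => e e0.
  have B1 : 0 < `|B| + 1 by rewrite ltr_wpDl.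
  have d0 : 0 < Num.min s (e / (`|B| + 1)) by rewrite lt_min s0 divr_gt0.
  rewrite near_withinE; apply: filterS (nbhsx_ballx (0 : R) _ d0) => k.
  rewrite -ball_normE/= sub0r normrN lt_min => /andP[ks kB] k0.
  have -> : F (y s) - k^-1 *: (y (k *: 1 + s) - y s) =
      - (k^-1 *: (y (s + k) - y s - k *: F (y s))).
    rewrite (scalerBr k^-1 (y (s + k) - y s)) scalerA mulVf// scale1r opprB.
    by rewrite [k *: 1]mulr1 [k + s]addrC.
  rewrite normrN normrZ normfV ler_pdivrMl ?normr_gt0//.
  rewrite (le_trans (yB _ ks))// expr2 mulrA mulrC ler_wpM2l//.
  apply: (@le_trans _ _ ((`|B| + 1) * `|k|)); first by rewrite ler_wpM2r// lerDl.
  by rewrite mulrC -ler_pdivlMr// ltW.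
split; first by apply/cvg_ex; exists (F (y s)).
exact: cvg_lim cvgy.
Qed.

Lemma lipschitz_abs_continuous (R : realType) (V : normedModType R) (a b M : R)
    (x : R -> V) : 0 <= M ->
  (forall s s', a <= s <= b -> a <= s' <= b -> `|x s - x s'| <= M * `|s - s'|) ->
  abs_continuous a b x.
Proof.
move=> M0 xM e e0; have M1 : 0 < M + 1 by rewrite ltr_wpDl.
exists (e / (M + 1)) => [|n s sab _ sd]; first by rewrite divr_gt0.
apply: (@le_lt_trans _ _ ((M + 1) * \sum_(i < n) ((s i).2 - (s i).1))).
  rewrite mulr_sumr; apply: ler_sum => i _; have [as_ ss sb] := sab i.
  apply: le_trans (xM _ _ _ _) _; [by lra|by lra|].
  by rewrite ger0_norm ?subr_ge0// ler_wpM2r ?subr_ge0// lerDl.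
by rewrite mulrC -ltr_pdivlMr.
Qed.

Lemma abs_continuous_within (R : realType) (V : normedModType R) (a b : R)
    (x : R -> V) : abs_continuous a b x -> {within `[a, b], continuous x}.
Proof.
move=> acx; apply/subspace_continuousP => s; rewrite /= in_itv/= => sab.
apply/cvgrPdist_lt => e e0; have [d d0 hd] := abs_continuous_dist acx e0.
rewrite /within/=; apply: filterS (nbhsx_ballx (s : R) _ d0) => s'.
by rewrite -ball_normE/= in_itv/= => ss' s'ab; exact: hd.
Qed.

Lemma lebesgue_measurable_cst (R : realType) n (D : set R) (v : 'rV[R]_n) :
  measurable (D : set (caratheodory_type (@wlength R idfun)^*%mu)) ->
  lebesgue_measurable_fun D (fun=> v).
Proof. by move=> mD; exact: measurable_cst. Qed.

Lemma lebesgue_measurable_fun_if (R : realType) n (D : set R) (a : R)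
    (u1 u2 : R -> 'rV[R]_n) :
  lebesgue_measurable_fun D u1 -> lebesgue_measurable_fun D u2 ->
  lebesgue_measurable_fun D (fun s => if s < a then u1 s else u2 s).
Proof.
move=> m1 m2 mD Y mY.
have mI : measurable (`]-oo, a[%classic : set (caratheodory_type (@wlength R idfun)^*%mu)).
  by apply: sub_caratheodory; exact: measurable_itv.
rewrite (_ : _ `&` _ = (`]-oo, a[ `&` (D `&` u1 @^-1` Y)) `|`
    (~` `]-oo, a[ `&` (D `&` u2 @^-1` Y))).
  apply: measurableU; apply: measurableI => //.
  - exact: m1.
  - exact: measurableC.
  - exact: m2.
apply/seteqP; split => s /=; rewrite in_itv/=; case: ltP => sa.
- by move=> [Ds Ys]; left.
- by move=> [Ds Ys]; right; split => //; apply/negP; rewrite -leNgt.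
- by move=> [[_ []]//|[]].
- by move=> [[]|[_ []]]//.
Qed.

Lemma is_derive_translate (R : realType) (V : normedModType R) (x : R -> V)
    (s t : R) (v : V) :
  is_derive (s + t) 1 x v -> is_derive s 1 (fun a => x (a + t)) v.
Proof.
move=> [dx xE].
have E : (fun h : R => h^-1 *: (x (h *: 1 + s + t) - x (s + t))) =
    (fun h : R => h^-1 *: (x (h *: 1 + (s + t)) - x (s + t))).
  by apply/funext => h; rewrite addrA.
split; first by rewrite /derivable/= E.
by rewrite /derive/= E.
Qed.

Section trajectory_value.
Context (R : realType) (Tmax : R) (f : state R -> control R -> state R)
  (L M K : R) (g nu : state R -> R) (Phi : control R -> state R -> R -> state R).
Local Notation U := (control_set Tmax).
Hypotheses (Tmax0 : 0 < Tmax) (L0 : 0 < L)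
  (fL : forall x y u, U u -> `|f x u - f y u| <= L * `|x - y|)
  (fM : forall x u, U u -> `|f x u| <= M)
  (gK : forall x y, `|g x - g y| <= K * `|x - y|)
  (nuK : forall x y, `|nu x - nu y| <= K * `|x - y|)
  (Phi0 : forall u r, U u -> Phi u r 0 = r)
  (PhiF : forall u r, U u -> flow_curve (f ^~ u) M (L * M) (Phi u r)).

Local Notation V := (schedule_value U g nu Phi).

Lemma control_set0 : U 0.
Proof.
by split; rewrite !mxE ?oppr_le0 ?lexx ?(ltW Tmax0) ?divr_ge0 ?pi_ge0.
Qed.

Let M0 : 0 <= M := schedule_bound_ge0 control_set0 fM.
Let K0 : 0 <= K := schedule_lip_ge0 gK.

(** Arcs are glued from the last one backwards. The Lipschitz bound survives gluing and yields
    absolute continuity afterwards. [E] lists the ends of the arcs, where the control may jump or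
    the curve may lack a two-sided derivative. *)
Lemma schedule_trajectory l r t c : schedule U t l -> cost_le g nu Phi c r l ->
  exists x u (E : seq R),
    [/\ admissible_control Tmax u, x (- t) = r,
        forall s s', - t <= s <= 0 -> - t <= s' <= 0 -> `|x s - x s'| <= M * `|s - s'|,
        forall s, - t <= s <= 0 -> s \notin E -> is_derive s 1 x (f (x s) (u s)) &
        (forall s, - t <= s <= 0 -> g (x s) <= c) /\ nu (x 0) <= c].
Proof.
elim: l r t => [r t /= -> [nc gc]|[u0 h] l IH r t /= [Uu h0 tl] [gc cl]].
  exists (fun=> r), (fun=> 0), [:: 0]; split => //.
  - split; last by move=> s _; exact: control_set0.
    by apply: lebesgue_measurable_cst; apply: sub_caratheodory; exact: measurable_itv.
  - by move=> s s' _ _; rewrite subrr normr0 mulr_ge0.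
  - by move=> s; rewrite oppr0 -eq_le eq_sym => /eqP ->; rewrite inE eqxx.
have t'0 := schedule_ge0 tl.
have [x [u [E [[mu Uu'] xt xM xd [xg xnu]]]]] := IH _ _ tl cl.
set t' := t - h in t'0 xt xM xd xg.
have tE : - t = - t' - h by rewrite /t'; ring.
pose y s := if s < - t' then Phi u0 r (s + t) else x s.
exists y, (fun s => if s < - t' then u0 else u s), [:: - t, - t' & E].
have yl s : s < - t' -> y s = Phi u0 r (s + t) by rewrite /y => ->.
have yr s : - t' <= s -> y s = x s by rewrite /y ltNge => ->.
have joint : Phi u0 r (- t' + t) = x (- t').
  by rewrite xt; congr Phi; rewrite /t'; ring.
have PhiM s s' : `|Phi u0 r (s + t) - Phi u0 r (s' + t)| <= M * `|s - s'|.
  have [H _] := PhiF r Uu; rewrite (le_trans (H _ _))//.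
  by rewrite (_ : s + t - (s' + t) = s - s')//; ring.
split.
- split; first by apply: lebesgue_measurable_fun_if => //;
    apply: lebesgue_measurable_cst; apply: sub_caratheodory; exact: measurable_itv.
  by move=> s s0; case: ifP => // _; exact: Uu'.
- have [ht|] := ltP (- t) (- t').
    by rewrite yl// addNr Phi0.
  rewrite tE => h'; have hE : h = 0 by lra.
  by rewrite hE subr0 yr// xt hE Phi0.
- have cross s s' : s < - t' -> - t' <= s' -> s' <= 0 -> `|y s - y s'| <= M * `|s - s'|.
    move=> st' s't' s'0; rewrite yl// yr// -(subrKA (x (- t'))).
    rewrite (le_trans (ler_normD _ _))// -{1}joint.
    have h1 := PhiM s (- t').
    have h2 : `|x (- t') - x s'| <= M * `|- t' - s'|.
      by apply: xM; [rewrite lexx oppr_le0|rewrite s't'].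
    apply: (le_trans (lerD h1 h2)); rewrite -mulrDr ler_wpM2l//.
    by rewrite !ler0_norm ?subr_le0//; lra.
  move=> s s' /andP[s1 s2] /andP[s'1 s'2].
  have [sl|sr] := ltP s (- t'); have [s'l|s'r] := ltP s' (- t').
  + by rewrite !yl//; exact: PhiM.
  + exact: cross.
  + by rewrite distrC (distrC s); exact: cross.
  + by rewrite !yr//; apply: xM; rewrite ?sr ?s'r.
- move=> s /andP[s1 s2]; rewrite !inE !negb_or => /and3P[st st' sE].
  have [sl|sr] := ltP s (- t').
    have st0 : 0 < s + t by rewrite -ltrBlDr sub0r lt_neqAle eq_sym st.
    have dP := flow_curve_is_derive (ltW L0) (fun x y => fL x y Uu) (PhiF r Uu) st0.
    rewrite yl//; apply: near_eq_is_derive (is_derive_translate dP).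
    have d0 : 0 < - t' - s by rewrite subr_gt0.
    apply: filterS (nbhsx_ballx (s : R) _ d0) => a.
    by rewrite -ball_normE/= ltr_norml => /andP[? _]; rewrite yl//; lra.
  have s_gt : - t' < s by rewrite lt_neqAle eq_sym st'.
  have sI : - t' <= s <= 0 by rewrite sr.
  rewrite yr//; apply: near_eq_is_derive (xd s sI sE).
  have d0 : 0 < s + t' by rewrite -(opprK t') subr_gt0.
  apply: filterS (nbhsx_ballx (s : R) _ d0) => a.
  by rewrite -ball_normE/= ltr_norml => /andP[_ ?]; rewrite yr//; lra.
- split; last by rewrite yr// oppr_le0.
  move=> s /andP[s1 s2]; have [sl|sr] := ltP s (- t').
    by rewrite yl//; apply: gc; lra.
  by rewrite yr//; apply: xg; rewrite sr.
Qed.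

Lemma trajectory_range (x : R -> state R) t : 0 <= t -> abs_continuous (- t) 0 x ->
  exists2 m : R, sup [set g (x tau) | tau in `[- t, 0]] = m &
    (exists2 tau, - t <= tau <= 0 & g (x tau) = m) /\
    forall tau, - t <= tau <= 0 -> g (x tau) <= m.
Proof.
move=> t0 acx.
have cg : continuous g by apply: lipschitz_bound_continuous => a b; exact: gK.
have [tau tI [-> H]] := running_max_attained t0 cg (abs_continuous_within acx).
exists (g (x tau)) => //; split; first by exists tau.
by move=> tau' tI'; apply: H; rewrite in_itv/=.
Qed.

Lemma trajectory_cost_obstacle x u r t : 0 <= t -> trajectories Tmax f r t (x, u) ->
  g r <= trajectory_cost g nu t x.
Proof.
move=> t0 [_ /= acx _ xr]; rewrite /trajectory_cost.
have [m -> [_ Hm]] := trajectory_range t0 acx.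
by rewrite le_max -xr Hm ?orbT// lexx oppr_le0.
Qed.

Lemma schedule_trajectory_cost l r t c : schedule U t l -> cost_le g nu Phi c r l ->
  exists2 ru, trajectories Tmax f r t ru & trajectory_cost g nu t ru.1 <= c.
Proof.
move=> tl cl; have t0 := schedule_ge0 tl.
have [x [u [E [ax xr xM xd [xg xnu]]]]] := schedule_trajectory tl cl.
have acx : abs_continuous (- t) 0 x by exact: lipschitz_abs_continuous xM.
exists (x, u); last first.
  rewrite /trajectory_cost/= ge_max xnu/=.
  by have [m -> [[tau tI <-] _]] := trajectory_range t0 acx; exact: xg.
split => //=.
have cE : countable [set` E] by exact/finite_set_countable/finite_seq.
exists [set` E]; split.
- by apply: countable_measurable cE => a; exact: measurable_set1.
- exact: countable_lebesgue_measure0.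
- move=> s /= H; apply: contrapT => sE; apply: H => sI; apply: xd.
    by move: sI; rewrite in_itv.
  exact/negP.
Qed.

Lemma value_function_le r t : 0 <= t -> value_function Tmax f g nu (r, t) <= V (r, t).
Proof.
move=> t0; apply: (schedule_value_ge control_set0 fM gK Phi0 PhiF t0) => l c tl cl.
have [ru tru ruc] := schedule_trajectory_cost tl cl.
apply: le_trans ruc; apply: ge_inf; last by exists ru.
by exists (g r) => _ [[x u] tr <-]; exact: trajectory_cost_obstacle tr.
Qed.

(* At a.e. time the trajectory is followed to first order by the flow of the
   constant control [u s]; the dynamic programming inequality for that flow
   gives a nonnegative Dini derivative. *)
Lemma schedule_value_along_trajectory (x : R -> state R) (u : R -> control R)
    (t m s e : R) :
  admissible_control Tmax u -> - t <= s -> s < 0 -> 0 < e ->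
  is_derive s 1 x (f (x s) (u s)) -> g (x s) <= m ->
  exists2 d : R, 0 < d & forall k : R, 0 < k -> k < d -> s + k <= 0 ->
    Num.max (V (x s, - s)) m <= Num.max (V (x (s + k), - (s + k))) m + e * k.
Proof.
move=> [_ Uu] ts s0 e0 dx gm.
have [Vm|mV] := leP (V (x s, - s)) m.
  exists 1 => // k k0 _ _.
  by rewrite -[leLHS]addr0 lerD ?le_max ?lexx ?orbT// mulr_ge0 ?ltW.
have {}Uu : U (u s) by apply: Uu; exact: ltW.
have t0 : 0 <= t by rewrite -oppr_le0 (le_trans ts)// ltW.
pose A : R := K * expR (L * t).
have A0 : 0 <= A by rewrite mulr_ge0// expR_ge0.
have A1 : 0 < 2 * A + 1 by rewrite ltr_wpDl// mulr_ge0.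
(* The trajectory and the flow each leave their common tangent by at most this times [k]; the
   Lipschitz factor of [V] is at most [A], so [V] changes by at most [e * k]. *)
have e10 : 0 < e / (2 * A + 1) by rewrite divr_gt0.
have [d1 d10 Hd1] := is_derive_right dx e10.
have [d2 d20 Hd2] := quadratic_small (L * M) e10.
have KM0 : 0 <= K * M by exact: mulr_ge0.
have KM1 : 0 < K * M + 1 by rewrite ltr_wpDl.
(* For smaller [k] the bound [m + K * M * k] on [g] along the arc stays below [V (x s, - s)], so the
   obstacle cannot dominate in the dynamic programming inequality. *)
have d30 : 0 < (V (x s, - s) - m) / (K * M + 1) by rewrite divr_gt0// subr_gt0.
exists (Num.min (Num.min d1 d2) ((V (x s, - s) - m) / (K * M + 1))).
  by rewrite !lt_min d10 d20.
move=> k k0; rewrite !lt_min -andbA => /and3P[kd1 kd2 kd3] sk0.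
have ksk : 0 <= - (s + k) by rewrite oppr_ge0.
pose y := Phi (u s) (x s).
have xy : `|x (s + k) - y k| <= 2 * (e / (2 * A + 1) * k).
  have h1 := Hd1 k k0 kd1.
  have h2 := le_trans (flow_quadratic Phi0 PhiF (x s) Uu (ltW k0)) (Hd2 k (ltW k0) kd2).
  have -> : x (s + k) - y k = (x (s + k) - x s - k *: f (x s) (u s)) -
      (y k - x s - k *: f (x s) (u s)).
    by apply/matrixP => i j; rewrite !mxE; ring.
  by rewrite (le_trans (ler_normB _ _))// mulr2n mulrDl mul1r lerD.
have Vxy : V (y k, - (s + k)) <= V (x (s + k), - (s + k)) + e * k.
  have h := schedule_value_lipschitz_state L0 control_set0 fL fM gK nuK
    Phi0 PhiF (x (s + k)) (y k) ksk.
  apply: le_trans h _.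
  rewrite lerD2l mulrA.
  have AA : K * expR (L * - (s + k)) <= A.
    by rewrite ler_wpM2l// ler_expR ler_wpM2l ?(ltW L0)//; lra.
  apply: (le_trans (ler_pM (mulr_ge0 K0 (expR_ge0 _)) (normr_ge0 _) AA xy)).
  have -> : A * (2 * (e / (2 * A + 1) * k)) = (2 * A) / (2 * A + 1) * (e * k).
    by field; rewrite gt_eqF.
  apply: ler_piMl; first by rewrite mulr_ge0 ?ltW.
  by rewrite ler_pdivrMr// mul1r lerDl.
suff : V (x s, - s) <= Num.max (m + K * M * k) (V (y k, - (s + k))).
  rewrite le_max => /orP[H|H].
    exfalso; move: kd3; rewrite ltr_pdivlMr// => kd3.
    have kE : k * (K * M + 1) = K * M * k + k by ring.
    have := lt_le_trans kd3 (lerB H (lexx m)).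
    by rewrite kE addrAC subrr add0r gtrDl ltNge ltW.
  by rewrite (le_trans H)// (le_trans Vxy)// lerD2r le_max lexx.
have -> : - s = - (s + k) + k by ring.
apply: (schedule_value_dpp control_set0 fM gK Phi0 PhiF Uu ksk (ltW k0)).
  move=> a /andP[a0 ak]; rewrite le_max; apply/orP; left.
  have := le_trans (ler_norm _) (gK (Phi (u s) (x s) a) (x s)); rewrite lerBlDr => h.
  rewrite (le_trans h)// addrC lerD// -mulrA ler_wpM2l//.
  by rewrite (le_trans (flow_dist Phi0 PhiF (x s) Uu a0))// ler_wpM2l.
by rewrite le_max lexx orbT.
Qed.

Lemma schedule_value_le_cost r (t : R) x u : 0 <= t -> trajectories Tmax f r t (x, u) ->
  V (r, t) <= trajectory_cost g nu t x.
Proof.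
move=> t0 [au /= acx dx xr]; rewrite /trajectory_cost.
have [m -> [_ Hm]] := trajectory_range t0 acx.
pose h s := Num.max (V (x s, - s)) m.
pose A : R := K * expR (L * t).
have A0 : 0 <= A by rewrite mulr_ge0// expR_ge0.
have Vlip s s' : - t <= s <= 0 -> - t <= s' <= 0 ->
    `|V (x s, - s) - V (x s', - s')| <= A * (`|x s - x s'| + M * `|s - s'|).
  move=> sI s'I.
  have := @schedule_value_lipschitz _ _ _ _ _ _ _ _ _ _ _ L0 control_set0 fL fM gK nuK
    Phi0 PhiF t (x s) (x s') (- s) (- s').
  rewrite (_ : - s - - s' = - (s - s')) ?normrN; last by ring.
  by apply; lra.
have ach : abs_continuous (- t) 0 h.
  move=> e e0.
  have A1 : 0 < 2 * (A + 1) by rewrite mulr_gt0// ltr_wpDl.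
  have eA : 0 < e / (2 * (A + 1)) by rewrite divr_gt0.
  have [d d0 Hd] := acx _ eA.
  have M1 : 0 < M + 1 by rewrite ltr_wpDl.
  exists (Num.min d (e / (2 * (A + 1)) / (M + 1))); first by rewrite lt_min d0 divr_gt0.
  move=> n s sI tr; rewrite lt_min => /andP[sd sM].
  have h1 := Hd n s sI tr sd.
  have h2 : M * (\sum_(i < n) ((s i).2 - (s i).1)) <= e / (2 * (A + 1)).
    rewrite ltr_pdivlMr// in sM; apply: le_trans (ltW sM).
    rewrite mulrC ler_wpM2l ?lerDl//.
    by apply: sumr_ge0 => i _; have [_ ? _] := sI i; rewrite subr_ge0.
  apply: (@le_lt_trans _ _ (A * (\sum_(i < n) `|x (s i).2 - x (s i).1| +
      M * (\sum_(i < n) ((s i).2 - (s i).1))))).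
    rewrite mulr_sumr -big_split mulr_sumr; apply: ler_sum => i _ /=.
    have [i1 i2 i3] := sI i.
    have maxl (a b : R) : `|Num.max a m - Num.max b m| <= `|a - b|.
      rewrite ler_norml /Num.max; have := ler_norm (a - b); have := ler_norm (b - a).
      by rewrite (distrC b a); case: ltP => ?; case: ltP => ?; lra.
    rewrite (le_trans (maxl _ _))// (le_trans (Vlip _ _ _ _))//; [lra|lra|].
    by rewrite [`|(s i).2 - (s i).1|]ger0_norm// subr_ge0.
  have -> : e = (A + 1) * (e / (2 * (A + 1)) + e / (2 * (A + 1))).
    by field; rewrite gt_eqF// ltr_wpDl.
  apply: (@le_lt_trans _ _ (A * (e / (2 * (A + 1)) + e / (2 * (A + 1))))).
    by rewrite ler_wpM2l// lerD// ltW.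
  have ee : 0 < e / (2 * (A + 1)) + e / (2 * (A + 1)) by exact: addr_gt0.
  by rewrite (ltr_pM2r ee) ltrDl.
have : h (- t) <= h 0.
  apply: (abs_continuous_nondecreasing _ ach dx); first by rewrite oppr_le0.
  move=> e e0 s ts s0 /contrapT/=; rewrite in_itv/= ts (ltW s0) => /(_ isT) ds.
  apply: (schedule_value_along_trajectory au ts s0 e0 ds).
  by apply: Hm; rewrite ts ltW.
(* At time 0 the value is the maximum of [nu] and [g], and [g (x 0) <= m], so [h 0] is at most the
   cost. *)
rewrite /h oppr0 opprK xr (schedule_value0 nu control_set0 fM gK Phi0 PhiF).
have g0 : g (x 0) <= m by apply: Hm; rewrite lexx oppr_le0 t0.
move=> H; apply: le_trans (le_trans H _); first by rewrite le_max lexx.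
by rewrite !ge_max !le_max lexx g0 !lexx !orbT.
Qed.

Lemma value_function_schedule r t : 0 <= t ->
  value_function Tmax f g nu (r, t) = V (r, t).
Proof.
move=> t0; apply/eqP; rewrite eq_le value_function_le//=.
apply: lb_le_inf.
  have [l [c [tl cl _]]] := schedule_value_adherent nu control_set0 fM gK Phi0 PhiF
    r t0 (ltr01 : 0 < (1 : R)).
  have [ru tru _] := schedule_trajectory_cost tl cl.
  by exists (trajectory_cost g nu t ru.1), ru.
by move=> _ [[x u] tr <-]; exact: schedule_value_le_cost tr.
Qed.

End trajectory_value.

(** * Existence and uniqueness of the solution *)

(** Every large constant is allowed, so [g] and [nu] can share one. *)
Lemma lipschitz_constant (R : realType) (V : normedModType R) (h : V -> R) :
  lipschitz h -> exists K : R, forall K', K <= K' ->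
    forall x y, `|h x - h y| <= K' * `|x - y|.
Proof.
move=> [K [_ HK]]; exists (K + 1) => K' KK' x y.
by apply: (HK K' _ (x, y)) => //; rewrite (lt_le_trans _ KK')// ltrDl.
Qed.

Theorem theorem4p2 (R : realType) (Tmax : R)
    (f : state R -> control R -> state R)
    (rho_min rho_max m_min m_max : R) (C : set (state R))
    (g nu : state R -> R) (Lf : R)
    (Tmax_gt0 : 0 < Tmax)
    (rho_min_gt0 : 0 < rho_min) (rho_min_max : rho_min < rho_max)
    (m_min_eq0 : m_min = 0) (m_min_max : m_min < m_max)
    (f_continuous : {within [set p : state R * control R |
         control_set Tmax p.2], continuous (fun p => f p.1 p.2)})
    (f_bounded : exists M : R, forall r u,
       control_set Tmax u -> `|f r u| <= M)
    (Lf_gt0 : 0 < Lf)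
    (f_lipschitz : forall r1 r2 u, control_set Tmax u ->
       `|f r1 u - f r2 u| <= Lf * `|r1 - r2|)
    (f_convex : forall r, constraint_set rho_min rho_max m_min m_max r ->
       compact (f r @` control_set Tmax) /\
       convex_set (f r @` control_set Tmax))
    (C_closed : closed C)
    (C_sub : C `<=` constraint_set rho_min rho_max m_min m_max)
    (g_lipschitz : lipschitz g) (nu_lipschitz : lipschitz nu)
    (g_levelset : forall r,
       g r <= 0 <-> constraint_set rho_min rho_max m_min m_max r)
    (nu_levelset : forall r, nu r <= 0 <-> C r) :
  let H := hamiltonian Tmax f in
  let omega := value_function Tmax f g nu in
  viscosity_solution H g nu omega /\
  forall w : state R * R -> R, viscosity_solution H g nu w ->
    forall r t, 0 <= t -> w (r, t) = omega (r, t).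
Proof.
move=> H omega.
have [M fM] := f_bounded.
have [K1 HK1] := lipschitz_constant g_lipschitz.
have [K2 HK2] := lipschitz_constant nu_lipschitz.
pose K : R := Num.max K1 K2.
have gK : forall x y, `|g x - g y| <= K * `|x - y|.
  by apply: HK1; rewrite le_max lexx.
have nuK : forall x y, `|nu x - nu y| <= K * `|x - y|.
  by apply: HK2; rewrite le_max lexx orbT.
have U0 : control_set Tmax 0 := control_set0 Tmax_gt0.
have M0 := schedule_bound_ge0 U0 fM.
have K0 := schedule_lip_ge0 gK.
(* One flow curve is chosen for each control and initial point; outside the control set the value is
   arbitrary. *)
have /choice[Phi HPhi] : forall ur : control R * state R, exists y : R -> state R,
    control_set Tmax ur.1 -> y 0 = ur.2 /\ flow_curve (f ^~ ur.1) M (Lf * M) y.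
  move=> [u r] /=; have [Uu|nUu] := pselect (control_set Tmax u).
    have [y y0 yF] := ex_flow_curve Lf_gt0 (fun x y => f_lipschitz x y u Uu)
      (fun x => fM x u Uu) r.
    by exists y.
  by exists (fun=> 0) => /nUu.
pose Phi' u r := Phi (u, r).
have Phi0 u r : control_set Tmax u -> Phi' u r 0 = r.
  by move=> Uu; have [] := HPhi (u, r) Uu.
have PhiF u r : control_set Tmax u -> flow_curve (f ^~ u) M (Lf * M) (Phi' u r).
  by move=> Uu; have [] := HPhi (u, r) Uu.
pose V := schedule_value (control_set Tmax) g nu Phi'.
have omegaE p : 0 <= p.2 -> omega p = V p.
  case: p => r t /= t0.
  exact: (value_function_schedule Tmax_gt0 Lf_gt0 f_lipschitz fM gK nuK Phi0 PhiF).
have cV : {within [set p | 0 <= p.2], continuous V}.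
  exact: (schedule_value_continuous Lf_gt0 U0 f_lipschitz fM gK nuK Phi0 PhiF).
have V0 r : V (r, 0) = Num.max (nu r) (g r).
  exact: (schedule_value0 nu U0 fM gK Phi0 PhiF).
have Vsub phi p : C1_on [set q : state R * R | 0 < q.2] phi -> 0 < p.2 ->
    local_max (fun x => V x - phi x) p -> qvi_operator H g V phi p <= 0.
  exact: (schedule_value_subsolution U0 fM gK Phi0 PhiF).
have Vsup phi p : C1_on [set q : state R * R | 0 < q.2] phi -> 0 < p.2 ->
    local_min (fun x => V x - phi x) p -> 0 <= qvi_operator H g V phi p.
  exact: (schedule_value_supersolution Lf_gt0 U0 f_lipschitz fM gK Phi0 PhiF).
split.
  (* Agreement is known for nonnegative times only, which covers a neighbourhood of each point with
     positive time and so carries local extrema over. *)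
  have near_pos (p : state R * R) : 0 < p.2 -> \forall q \near p, omega q = V q.
    move=> p0; apply: filterS (nbhsx_ballx p _ p0) => q [_].
    by rewrite -ball_normE/= ltr_norml => h; apply: omegaE; lra.
  split.
  - apply: subspace_eq_continuous cV => p.
    by rewrite inE/= => p0; rewrite /from_subspace omegaE.
  - by move=> r; rewrite omegaE/= ?V0.
  - move=> phi C1 p p0; have pE := omegaE p (ltW p0).
    have near_p := near_pos p p0.
    have eq_qvi : qvi_operator H g omega phi p = qvi_operator H g V phi p.
      by rewrite /qvi_operator pE.
    rewrite eq_qvi; split=> lext; [apply: Vsub|apply: Vsup] => //.
      by apply: filterS2 near_p lext => q -> /=; rewrite pE.
    by apply: filterS2 near_p lext => q -> /=; rewrite pE.
move=> w [cw w0 Hw] r t t0; rewrite omegaE//.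
have HH := drift_hamiltonian_lipschitz U0 f_lipschitz fM.
(* Both functions are sub- and supersolutions with the same initial values, so comparison applies in
   each direction. *)
apply/eqP; rewrite eq_le; apply/andP; split.
  apply: (viscosity_comparison (ltW Lf_gt0) M0 K0 HH gK cw cV) => //.
  - by move=> x; rewrite w0 V0.
  - by move=> phi p C1 p0; have [+ _] := Hw phi C1 p p0.
apply: (viscosity_comparison (ltW Lf_gt0) M0 K0 HH gK cV cw) => //.
- by move=> x; rewrite w0 V0.
- by move=> phi p C1 p0; have [_ +] := Hw phi C1 p p0.
Qed.
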